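(* Let $\alpha\in(0,1)$ and let $s\ge 1$ be an integer. Suppose that $f:[0,\infty)\times\mathbb{R}^s\to\mathbb{R}^s$ is continuous and that there exists a nonnegative function $L:[0,\infty)\to[0,\infty)$ which is bounded (or continuous) such that $$\|f(t,x)-f(t,y)\|\le L(t)\,\|x-y\|\qquad\text{for all } t\in[0,\infty),\ x,y\in\mathbb{R}^s.$$ Then for every $x_0\in\mathbb{R}^s$ the equation $$D_{0+}^{\alpha}x(t)=f(t,x(t)),\qquad t>0,$$ with the initial condition $$\lim_{t\to0^+}t^{1-\alpha}x(t)=x_0$$ has a unique solution in the space $C_{1-\alpha}([0,\infty),\mathbb{R}^s)$.
   Context: $\|\cdot\|$ is an arbitrary norm on $\mathbb{R}^s$. The Riemann--Liouville fractional integral of order $\beta>0$ is $I_{0+}^{\beta}x(t):=\frac{1}{\Gamma(\beta)}\int_0^t(t-\tau)^{\beta-1}x(\tau)\,d\tau$, and the Riemann--Liouville fractional derivative of order $\alpha\in(0,1)$ is $D_{0+}^{\alpha}x(t):=\frac{d}{dt}I_{0+}^{1-\alpha}x(t)$. $C_{1-\alpha}([0,\infty),\mathbb{R}^s)$ is the set of all continuous functions $x:(0,\infty)\to\mathbb{R}^s$ such that the limit $\lim_{t\to0^+}t^{1-\alpha}x(t)$ exists (in $\mathbb{R}^s$). *)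

(* Defs.v *)
From HB Require Import structures.
From mathcomp Require Import all_boot all_order all_algebra.
From mathcomp Require Import all_classical all_reals all_analysis.
Set Implicit Arguments.
Unset Strict Implicit.
Unset Printing Implicit Defensive.
Import Order.TTheory GRing.Theory Num.Theory.
Import numFieldNormedType.Exports.
Local Open Scope classical_set_scope.
Local Open Scope ring_scope.

(* An arbitrary norm on R^s, kept apart from the canonical (sup) norm of
   'rV[R]_s.  The latter only supplies the topology, which is the one induced
   by any norm since the dimension is finite. *)
Record is_norm (R : realType) (s : nat) (N : 'rV[R]_s -> R) : Prop := IsNorm {
  is_norm_ge0 : forall x, 0 <= N x ;
  is_norm_eq0 : forall x, N x = 0 -> x = 0 ;
  is_normZ : forall (a : R) x, N (a *: x) = `|a| * N x ;
  is_normD : forall x y, N (x + y) <= N x + N y }.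

Definition Gamma (R : realType) (z : R) : R :=
  (\int[lebesgue_measure]_(t in `]0%R, +oo[) (t `^ (z - 1) * expR (- t)))%R.

(* Functions on (0, oo) are represented by total functions on R; none of the
   definitions below depends on their values outside (0, oo).  In particular
   the integral is taken over the open interval (0, t). *)
Definition RL_integral (R : realType) (s : nat) (beta : R)
    (x : R -> 'rV[R]_s) (t : R) : 'rV[R]_s :=
  (Gamma beta)^-1 *:
  \row_i (\int[lebesgue_measure]_(tau in `]0%R, t[)
            ((t - tau) `^ (beta - 1) * x tau ord0 i))%R.

Definition RL_derivable (R : realType) (s : nat) (alpha : R)
    (x : R -> 'rV[R]_s) (t : R) : Prop :=
  derivable (RL_integral (1 - alpha) x) t 1.

(* Meaningful only under [RL_derivable], as [derive1] is total. *)
Definition RL_derivative (R : realType) (s : nat) (alpha : R)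
    (x : R -> 'rV[R]_s) (t : R) : 'rV[R]_s :=
  derive1 (RL_integral (1 - alpha) x) t.

(* The space C_gamma([0, oo), R^s). *)
Definition C_weighted (R : realType) (s : nat) (gamma : R) :
    set (R -> 'rV[R]_s) :=
  [set x : R -> 'rV[R]_s | {in `]0, +oo[, continuous x} /\
           cvg (t `^ gamma *: x t @[t --> 0^'+])].

Definition RL_solution (R : realType) (s : nat) (alpha : R)
    (f : R -> 'rV[R]_s -> 'rV[R]_s) (x0 : 'rV[R]_s)
    (x : R -> 'rV[R]_s) : Prop :=
  (forall t, 0 < t ->
     RL_derivable alpha x t /\ RL_derivative alpha x t = f t (x t)) /\
  t `^ (1 - alpha) *: x t @[t --> 0^'+] --> x0.

(* Main.v *)
(* With [I^b] the fractional integrals and [g r = f r (x r)], the Cauchy problem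
   is equivalent to the Volterra equation
     [x t = t^(alpha-1) x0 + 1/Gamma(alpha) \int_0^t (t-r)^(alpha-1) g r dr].
   Both directions rest on [I^(1-alpha) (I^alpha h) = \int_0^. h] (Fubini and the
   Beta integral), on the fundamental theorem of calculus, and on the injectivity
   of [I^(1-alpha)].  On each (0, T] the Volterra operator halves the distance
   weighted by [t^(alpha-1) e^(l t)] once [l] is large; this gives uniqueness, and
   the Picard iterates, which are defined on all of (0, oo), converge there to a
   solution.  Everything is done coordinatewise in the sup norm, to which the
   Lipschitz condition transfers by equivalence of norms. *)

Require Import Defs.
From HB Require Import structures.
From mathcomp Require Import all_boot all_order all_algebra.
From mathcomp Require Import all_classical all_reals all_analysis.
From mathcomp Require Import measurable_realfun.
From mathcomp Require Import ring lra.
Set Implicit Arguments.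
Unset Strict Implicit.
Unset Printing Implicit Defensive.
Import Order.TTheory GRing.Theory Num.Theory.
Import numFieldNormedType.Exports.
Local Open Scope classical_set_scope.
Local Open Scope ring_scope.

(** A solution may blow up like t^(alpha-1) at 0, and the kernel (t-r)^(alpha-1) blows up at r = t,
    so neither a sup norm on [0, T] nor calculus up to the endpoints is available. The working class
    is [weighted alpha]: functions continuous on (0, oo) and O(t^(alpha-1)) on each (0, T]. It asks
    for no limit at 0 and is stable under I^b, under x |-> f(t, x) by linear growth, and under the
    limit of the Picard iterates. All estimates in it reduce to Beta integrals. The initial
    condition meets the derivative in one place: I^(1-alpha) sends t^(alpha-1) to a constant and
    every function of the class that is o(t^(alpha-1)) at 0 to a function tending to 0. Hence the
    weighted limit x0 of a solution determines the limit at 0 of I^(1-alpha) x, which is the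
    constant of integration that the differential equation leaves open. *)

(** * Affine change of variables in Lebesgue integrals *)

Section affine_substitution.
Context {R : realType}.
Notation mu := (@lebesgue_measure R).
Variables (a b : R).
Hypothesis b0 : 0 < b.

Let phi (x : measurableTypeR R) : measurableTypeR R := a + b * x.

Let mphi : measurable_fun [set: measurableTypeR R] phi.
Proof.
apply: (@measurable_funD _ _ R) => //.
Qed.

Let phi_preimage (x y : bool) (p q : R) :
  phi @^-1` [set` Interval (BSide x p) (BSide y q)] =
  [set` Interval (BSide x ((p - a) / b)) (BSide y ((q - a) / b))].
Proof.
rewrite /phi; apply/seteqP; split => r /=; rewrite !in_itv/= => /andP[pr rq].
  apply/andP; split.
    by case: x pr => /= pr; rewrite ?ler_pdivrMr ?ltr_pdivrMr// mulrC ?lerBlDl ?ltrBlDl.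
  by case: y rq => /= rq; rewrite ?ler_pdivlMr ?ltr_pdivlMr// mulrC ?lerBrDl ?ltrBrDl.
apply/andP; split.
  by case: x pr => /= pr; rewrite ?(ler_pdivrMr, ltr_pdivrMr)// in pr;
    rewrite -?lerBlDl -?ltrBlDl mulrC.
by case: y rq => /= rq; rewrite ?(ler_pdivlMr, ltr_pdivlMr)// in rq;
    rewrite -?lerBrDl -?ltrBrDl mulrC.
Qed.

Let bnn : {nonneg R} := NngNum (ltW b0).

(* The instance is named because the proof [mphi] it needs cannot be inferred. *)
Let nu : {measure set (measurableTypeR R) -> \bar R} :=
  mscale bnn (measure_function_pushforward__canonical__measure_function_Measure mu mphi).

Let lebesgue_affine (A : set R) : measurable A -> mu A = nu A.
Proof.
apply: lebesgue_measure_unique => // _ [[p q] _ <-] /=.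
rewrite /mscale/= /pushforward phi_preimage !lebesgue_measure_itv/= !lte_fin.
rewrite ltr_pM2r ?invr_gt0// ltrD2r.
case: ifPn => pq; last by rewrite mule0.
by rewrite -!EFinD -EFinM; congr EFin; field; rewrite gt_eqF.
Qed.

(** Lebesgue measure equals [b] times its own image under r |-> a + b r, because the two agree on
    bounded intervals; the substitution is then integration against an image measure. *)
Lemma ge0_integral_affine (x y : bool) (p q : R) (f : R -> \bar R) :
  measurable_fun [set` Interval (BSide x p) (BSide y q)] f ->
  (forall r, r \in Interval (BSide x p) (BSide y q) -> (0 <= f r)%E) ->
  (\int[mu]_(r in [set` Interval (BSide x p) (BSide y q)]) f r =
   b%:E * \int[mu]_(r in
     [set` Interval (BSide x ((p - a) / b)%R) (BSide y ((q - a) / b)%R)])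
       f (a + b * r)%R)%E.
Proof.
move=> mf f0.
rewrite (@eq_measure_integral _ _ _ _ nu); last first.
  by move=> A mA _; exact: lebesgue_affine.
rewrite ge0_integral_mscale//; congr (_ * _)%E.
rewrite ge0_integral_pushforward//; first by rewrite phi_preimage.
by move=> r; rewrite inE => /f0.
Qed.

End affine_substitution.

(** * Elementary inequalities for real powers *)

Section powR_bounds.
Context {R : realType}.
Implicit Types x y v c : R.

Lemma le0_ger_powR c x y : c <= 0 -> 0 < x -> x <= y -> y `^ c <= x `^ c.
Proof.
move=> c0 x0 xy; have y0 := lt_le_trans x0 xy.
rewrite -[c]opprK !(powRN _ (- c)) lef_pV2 ?posrE ?powR_gt0//.
by apply: ge0_ler_powR; rewrite ?nnegrE ?oppr_ge0// ltW.
Qed.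

Lemma powR_le1 v c : 0 < v <= 1 -> 0 <= c -> v `^ c <= 1.
Proof. by move=> v01 c0; rewrite -(powRr0 v); exact: ger_powR. Qed.

(** The sum covers both signs of [c]: the power is at most 1 for c >= 0 and at most its value at 1/2
    for c <= 0. *)
Lemma powR_le_half v c : 2^-1 <= v <= 1 -> v `^ c <= 1 + 2^-1 `^ c.
Proof.
move=> /andP[v2 v1]; have v0 : 0 < v by apply: lt_le_trans v2; rewrite invr_gt0.
have [c0|/ltW c0] := leP 0 c.
  apply: (@le_trans _ _ 1); last by rewrite lerDl powR_ge0.
  by rewrite powR_le1// v0.
apply: (@le_trans _ _ (2^-1 `^ c)); last by rewrite lerDr.
by apply: le0_ger_powR.
Qed.

(** Inverse of the chain v^c <= max(1, v) <= 1 + v <= e^v. *)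
Lemma expRN_le_powR v c : 0 < v -> 0 <= c <= 1 -> expR (- v) <= v `^ (- c).
Proof.
move=> v0 /andP[c0 c1].
rewrite powRN expRN lef_pV2 ?posrE ?expR_gt0 ?powR_gt0//.
apply: (@le_trans _ _ (1 + v)); last exact: expR_ge1Dx.
have [v1|v1] := leP v 1.
  by apply: (@le_trans _ _ 1); [rewrite powR_le1 ?v0|rewrite lerDl ltW].
by rewrite (@le_trans _ _ v)// ?ler1_powR ?lerDr// ltW.
Qed.

End powR_bounds.

(** * The Beta integral: convergence, positivity, scaling *)

Section beta_integral.
Context {R : realType}.
Notation mu := (@lebesgue_measure R).
Implicit Types a b s t : R.

Lemma measurable_powR_affine (D : set R) (p q c : R) :
  measurable_fun D (fun u : R => (p + q * u) `^ c).
Proof.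
apply: measurable_funTS.
apply: (measurableT_comp (measurable_powR _)).
exact: measurable_funD.
Qed.

Lemma measurable_powR_subr (D : set R) (t c : R) :
  measurable_fun D (fun u : R => (t - u) `^ c).
Proof. by under eq_fun do rewrite -mulN1r; exact: measurable_powR_affine. Qed.

Lemma measurable_powR_kernel (D : set R) s t a b :
  measurable_fun D (fun u : R => (t - u) `^ a * (u - s) `^ b).
Proof.
apply: measurable_funM; first exact: measurable_powR_subr.
under eq_fun do rewrite addrC -[X in _ + X]mul1r.
exact: measurable_powR_affine.
Qed.

Lemma ge0_integral_oppr (p q : R) (f : R -> \bar R) :
  measurable_fun `]p, q[ f -> (forall r, p < r < q -> (0 <= f r)%E) ->
  (\int[mu]_(r in `]p, q[) f r = \int[mu]_(r in `](- q)%R, (- p)%R[) f (- r)%R)%E.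
Proof.
move=> mf f0.
rewrite (_ : `](- q)%R, (- p)%R[%classic =
    (-%R : _ -> measurableTypeR R) @^-1` `]p, q[); last first.
  by rewrite opp_preimage_itvbndbnd.
rewrite -ge0_integral_pushforward//=; last first.
  by move=> r; rewrite inE/= in_itv/=; exact: f0.
by apply: eq_measure_integral => //= A mA AS; exact/esym/lebesgue_measureN.
Qed.

(** The integrand may be singular at 0, so the fundamental theorem is applied on [1/(n+1), 1) with
    primitive u^b / b, and monotone convergence passes to the union. *)
Lemma integral_powR_le b : 0 < b ->
  (\int[mu]_(u in `]0%R, 1%R[) (u `^ (b - 1))%:E <= (b^-1)%:E)%E.
Proof.
move=> b0.
have mf (D : set R) : measurable_fun D (fun u => (u `^ (b - 1))%:E).
  by apply/measurable_EFinP/measurable_funTS; exact: measurable_powR.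
pose F n := `[(n.+1%:R^-1 : R), 1[%classic.
have FU : \bigcup_n F n = `]0%R, 1%R[%classic.
  by rewrite itv_open_bnd_bigcup; apply: eq_bigcupr => n _; rewrite add0r.
have ndF : nondecreasing_seq F.
  apply/nondecreasing_seqP => n; rewrite subsetEset; apply: subset_itvr.
  by rewrite bnd_simp lef_pV2 ?posrE// ler_nat.
have mF n : measurable (F n : set (measurableTypeR R)) by exact: measurable_itv.
have f0 n (u : R) : F n u -> (0 <= (u `^ (b - 1))%:E)%E.
  by move=> _; rewrite lee_fin powR_ge0.
have := @ge0_nondecreasing_set_cvg_integral _ (measurableTypeR R) R F
  (fun u => (u `^ (b - 1))%:E) mu ndF mF (fun n => mf (F n)) f0.
rewrite FU => /cvg_lim <- //.
apply: lime_le.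
  apply: ereal_nondecreasing_is_cvgn.
  exact: (@ge0_nondecreasing_set_nondecreasing_integral _ (measurableTypeR R) R
    F _ mu ndF mF (fun n => mf (F n)) f0).
apply: nearW => n.
(* For [n = 0] the interval [1, 1) is empty. *)
have [->|n0] := eqVneq n 0%N.
  by rewrite /F invr1 set_itvco0 integral_set0 lee_fin invr_ge0 ltW.
rewrite /F integral_itv_bndo_bndc//.
have n1 : n.+1%:R^-1 < 1 :> R by rewrite invf_lt1 ?ltr1n ?ltnS ?lt0n.
have n00 : 0 < n.+1%:R^-1 :> R by rewrite invr_gt0.
rewrite (@continuous_FTC2 _ _ (fun u => b^-1 * u `^ b))//.
- rewrite -EFinB lee_fin powR1 mulr1 gerBl.
  by rewrite mulr_ge0 ?powR_ge0// invr_ge0 ltW.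
- apply: derivable_within_continuous => x; rewrite in_itv/= => /andP[x0 _].
  by apply: derivable_powR; rewrite in_itv/= andbT (lt_le_trans n00).
- have cF (x : R) : 0 < x -> {for x, continuous (fun u => b^-1 * u `^ b)}.
    move=> x0; apply: differentiable_continuous; apply/derivable1_diffP.
    by apply: derivableM => //; apply: derivable_powR; rewrite in_itv/= andbT.
  split.
  + move=> x; rewrite in_itv/= => /andP[x0 _].
    apply: derivableM => //; apply: derivable_powR.
    by rewrite in_itv/= andbT (lt_trans n00).
  + by apply: cvg_at_right_filter; exact: cF.
  + by apply: cvg_at_left_filter; exact: cF.
- move=> x; rewrite in_itv/= => /andP[x0 _].
  have {}x0 := lt_trans n00 x0.
  rewrite derive1E deriveM//; last by apply: derivable_powR; rewrite in_itv/= andbT.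
  rewrite derive_cst scaler0 addr0.
  rewrite -derive1E powR_derive1 ?in_itv/= ?andbT//.
  by rewrite [LHS]mulrA mulVf ?mul1r// gt_eqF.
Qed.

End beta_integral.

Section beta_integral_scaling.
Context {R : realType}.
Notation mu := (@lebesgue_measure R).
Implicit Types a b s t : R.

(** Euler's Beta function; [a] governs the singularity at 1 and [b] the one at 0. *)
Definition beta_int a b : R :=
  \int[mu]_(u in `]0%R, 1%R[) ((1 - u) `^ (a - 1) * u `^ (b - 1)).

Lemma measurable_beta_kernel (D : set R) t a b :
  measurable_fun D (fun u : R => (t - u) `^ a * u `^ b).
Proof.
have := @measurable_powR_kernel R D 0 t a b.
by under eq_fun do rewrite subr0.
Qed.

Lemma integral_onem_powR_le a : 0 < a ->
  (\int[mu]_(u in `]0%R, 1%R[) ((1 - u) `^ (a - 1))%:E <= (a^-1)%:E)%E.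
Proof.
move=> a0; apply: le_trans (integral_powR_le a0).
(* The reflection u |-> 1 - u is obtained as a translation by 1 followed by a change of sign. *)
rewrite (@ge0_integral_affine R 1 1 ltr01 false true 0 1 (fun u => (u `^ (a - 1))%:E)).
- rewrite !divr1 mul1e subrr sub0r (@ge0_integral_oppr _ (- 1) 0).
  + rewrite opprK oppr0; under [X in (_ <= X)%E]eq_integral do rewrite mul1r.
    exact: lexx.
  + by apply/measurable_EFinP; exact: measurable_powR_affine.
  + by move=> r _; rewrite lee_fin powR_ge0.
- by apply/measurable_EFinP/measurable_funTS; exact: measurable_powR.
- by move=> r _; rewrite lee_fin powR_ge0.
Qed.

(** On each half of (0, 1) one of the two factors is bounded, so the kernel is dominated by a
    combination of the two one-sided powers. *)
Lemma integrable_beta a b : 0 < a -> 0 < b ->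
  mu.-integrable `]0%R, 1%R[
    (fun u => ((1 - u) `^ (a - 1) * u `^ (b - 1))%:E).
Proof.
move=> a0 b0.
have m1 (D : set R) (c : R) : measurable_fun D (fun u : R => u `^ c).
  by apply: measurable_funTS; exact: measurable_powR.
have m2 (D : set R) (c : R) : measurable_fun D (fun u : R => (1 - u) `^ c).
  exact: measurable_powR_subr.
have mK : measurable_fun (`]0%R, 1%R[%classic : set R)
    (fun u => ((1 - u) `^ (a - 1) * u `^ (b - 1))%:E).
  by apply/measurable_EFinP; exact: measurable_beta_kernel.
have i1 : mu.-integrable `]0%R, 1%R[ (fun u => (u `^ (b - 1))%:E).
  apply/integrableP; split; first by apply/measurable_EFinP; exact: m1.
  under eq_integral do rewrite gee0_abs ?lee_fin ?powR_ge0//.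
  by apply: le_lt_trans (integral_powR_le b0) _; rewrite ltry.
have i2 : mu.-integrable `]0%R, 1%R[ (fun u => ((1 - u) `^ (a - 1))%:E).
  apply/integrableP; split; first by apply/measurable_EFinP; exact: m2.
  under eq_integral do rewrite gee0_abs ?lee_fin ?powR_ge0//.
  by apply: le_lt_trans (integral_onem_powR_le a0) _; rewrite ltry.
pose Ca := 1 + 2^-1 `^ (a - 1) : R.
pose Cb := 1 + 2^-1 `^ (b - 1) : R.
have Ca0 : 0 <= Ca by rewrite addr_ge0// powR_ge0.
have Cb0 : 0 <= Cb by rewrite addr_ge0// powR_ge0.
have i3 : mu.-integrable `]0%R, 1%R[ ((fun u => Ca%:E * (u `^ (b - 1))%:E) \+
   (fun u => Cb%:E * ((1 - u) `^ (a - 1))%:E))%E.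
  by apply: integrableD => //; exact: integrableZl.
apply: le_integrable i3 => //.
move=> u /=; rewrite in_itv/= => /andP[u0 u1].
rewrite lee_fin.
rewrite ger0_norm ?mulr_ge0 ?powR_ge0//.
rewrite ger0_norm ?addr_ge0 ?mulr_ge0 ?powR_ge0//.
have [u2|u2] := leP u 2^-1.
  rewrite ler_wpDr ?mulr_ge0 ?powR_ge0//.
  rewrite ler_wpM2r ?powR_ge0// powR_le_half//; lra.
rewrite ler_wpDl ?mulr_ge0 ?powR_ge0//.
rewrite mulrC ler_wpM2r ?powR_ge0// powR_le_half//; lra.
Qed.

Lemma beta_int_ge0 a b : 0 <= beta_int a b.
Proof. by apply: Rintegral_ge0 => u _; rewrite mulr_ge0 ?powR_ge0. Qed.

Lemma EFin_beta_int a b : 0 < a -> 0 < b ->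
  (beta_int a b)%:E =
  (\int[mu]_(u in `]0%R, 1%R[) ((1 - u) `^ (a - 1) * u `^ (b - 1))%:E)%E.
Proof.
move=> a0 b0; rewrite /beta_int /Rintegral fineK//.
by apply: integrable_fin_num => //; exact: integrable_beta.
Qed.

(** Both exponents are nonpositive, so the integrand is at least 1 on (0, 1). *)
Lemma beta_int_gt0 a b : 0 < a <= 1 -> 0 < b <= 1 -> 0 < beta_int a b.
Proof.
move=> /andP[a0 a1] /andP[b0 b1]; apply: (@lt_le_trans _ _ 1) => //.
rewrite -lee_fin EFin_beta_int//.
have -> : 1%:E = (\int[mu]_(u in `]0%R, 1%R[) (cst 1%:E u))%E :> \bar R.
  rewrite integral_cst//= mul1e lebesgue_measure_itv/= lte_fin ltr01.
  by rewrite sube0.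
apply: ge0_le_integral => //.
- by apply/measurable_EFinP; exact: measurable_beta_kernel.
move=> u /=; rewrite in_itv/= => /andP[u0 u1]; rewrite lee_fin.
have h (v c : R) : 0 < v -> v <= 1 -> c <= 0 -> 1 <= v `^ c.
  move=> v0 v1 c0; have <- : 1 `^ c = 1 :> R by rewrite powR1.
  exact: le0_ger_powR.
have h1 : 1 <= (1 - u) `^ (a - 1) by apply: h; lra.
have h2 : 1 <= u `^ (b - 1) by apply: h; lra.
exact: mulr_ege1.
Qed.

Lemma integral_beta_itv s t a b : s < t -> 0 < a -> 0 < b ->
  (\int[mu]_(u in `]s, t[) ((t - u) `^ (a - 1) * (u - s) `^ (b - 1))%:E =
  ((t - s) `^ (a + b - 1) * beta_int a b)%:E)%E.
Proof.
move=> st a0 b0; have ts : 0 < t - s by rewrite subr_gt0.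
rewrite (@ge0_integral_affine R s (t - s) ts false true s t
  (fun u => ((t - u) `^ (a - 1) * (u - s) `^ (b - 1))%:E)).
- rewrite subrr mul0r divff ?gt_eqF//.
  under eq_integral => u.
    rewrite inE/= in_itv/= => /andP[u0 u1].
    rewrite (_ : t - (s + (t - s) * u) = (t - s) * (1 - u)); last by ring.
    rewrite (_ : s + (t - s) * u - s = (t - s) * u); last by ring.
    rewrite !powRM ?(ltW ts) ?(ltW u0) ?subr_ge0 ?(ltW u1)//.
    rewrite mulrACA EFinM.
    over.
  rewrite ge0_integralZl_EFin//=; last 3 first.
  + by move=> u _; rewrite lee_fin mulr_ge0 ?powR_ge0.
  + by apply/measurable_EFinP; exact: measurable_beta_kernel.
  + by rewrite mulr_ge0 ?powR_ge0.
  rewrite -EFin_beta_int// -!EFinM; congr EFin.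
  rewrite !mulrA; congr (_ * _).
  rewrite -{1}(powRr1 (ltW ts)) -!powRD ?(gt_eqF ts) ?implybT//.
  by congr (_ `^ _); ring.
- by apply/measurable_EFinP; exact: measurable_powR_kernel.
- by move=> r _; rewrite lee_fin mulr_ge0 ?powR_ge0.
Qed.

End beta_integral_scaling.

(** * Scalar fractional integrals on the weighted class *)

Section weighted_functions.
Context {R : realType}.
Notation mu := (@lebesgue_measure R).
Implicit Types (b c s t A : R) (h : R -> R).

(** The scalar Riemann-Liouville integral without the factor 1/Gamma(b), so that its constants are
    Beta values only. *)
Definition RLint b h t : R :=
  \int[mu]_(x in `]0%R, t[) ((t - x) `^ (b - 1) * h x).

(** The growth bound is local in [T] and replaces the limit at 0 of the space C_(1-c); for c > 0 it
    makes [h] integrable near 0. *)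
Definition weighted c h := {in `]0, +oo[, continuous h} /\
  forall T : R, exists M : R, 0 <= M /\
    forall t, 0 < t <= T -> `|h t| <= M * t `^ (c - 1).

Lemma integrable_cstM (d : measure_display) (T : measurableType d)
    (m : {measure set T -> \bar R}) (D : set T) (k : R) (f : T -> R) :
  measurable D -> m.-integrable D (EFin \o f) ->
  m.-integrable D (EFin \o (fun x => k * f x)).
Proof.
move=> mD ih; have := integrableZl mD k ih.
by congr (integrable _ _ _); apply/funext => x /=; rewrite EFinM.
Qed.

Lemma integrable_powR_kernel s t b c : s < t -> 0 < b -> 0 < c ->
  mu.-integrable `]s, t[
    (fun u => ((t - u) `^ (b - 1) * (u - s) `^ (c - 1))%:E).
Proof.
move=> st b0 c0; apply/integrableP; split.
  by apply/measurable_EFinP; exact: measurable_powR_kernel.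
under eq_integral do rewrite gee0_abs ?lee_fin ?mulr_ge0 ?powR_ge0//.
by rewrite integral_beta_itv// ltry.
Qed.

Lemma integrable_powR_kernel0 t b c : 0 < t -> 0 < b -> 0 < c ->
  mu.-integrable `]0, t[ (fun u => ((t - u) `^ (b - 1) * u `^ (c - 1))%:E).
Proof.
move=> t0 b0 c0; have := integrable_powR_kernel t0 b0 c0.
by congr (integrable _ _ _); apply/funext => u; rewrite subr0.
Qed.

Lemma Rintegral_powR_kernel0 t b c : 0 < t -> 0 < b -> 0 < c ->
  \int[mu]_(u in `]0, t[) ((t - u) `^ (b - 1) * u `^ (c - 1)) =
  t `^ (b + c - 1) * beta_int b c.
Proof.
move=> t0 b0 c0; rewrite /Rintegral.
rewrite -[RHS]/(fine (t `^ (b + c - 1) * beta_int b c)%:E) -[X in (X `^ (b + _ - _) * _)](subr0 t).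
rewrite -(integral_beta_itv t0 b0 c0); congr fine.
by apply: eq_integral => u _; rewrite subr0.
Qed.

Lemma measurable_pos_continuous (D : set R) h : measurable D ->
  D `<=` `]0, +oo[ -> {in `]0, +oo[, continuous h} -> measurable_fun D h.
Proof.
move=> mD D0 ch.
have mh : measurable_fun (`]0, +oo[%classic : set R) h.
  apply: open_continuous_measurable_fun; first exact: interval_open.
  by move=> x; rewrite inE; exact: ch.
exact: measurable_funS mh.
Qed.

Lemma measurable_RLint (D : set R) b t h : measurable D -> D `<=` `]0, +oo[ ->
  {in `]0, +oo[, continuous h} ->
  measurable_fun D (fun x => (t - x) `^ (b - 1) * h x).
Proof.
move=> mD D0 ch; apply: measurable_funM; last exact: measurable_pos_continuous.
exact: measurable_powR_subr.
Qed.

Lemma itv0_pos t : `]0, t[%classic `<=` (`]0, +oo[%classic : set R).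
Proof. by move=> x /=; rewrite !in_itv/= andbT => /andP[]. Qed.

(* e^(-v) <= v^(-e) trades the exponential for a small power of the kernel. *)
Lemma le_exp_kernel (b e l t x : R) : 0 <= e <= 1 -> 0 < l -> x < t ->
  (t - x) `^ (b - 1) * expR (l * x) <=
  l `^ (- e) * expR (l * t) * (t - x) `^ (b - e - 1).
Proof.
move=> e01 l0 xt; have tx : 0 < t - x by rewrite subr_gt0.
have -> : b - e - 1 = (b - 1) + - e by ring.
rewrite [_ `^ (b - 1 + _)]powRD ?(gt_eqF tx) ?implybT//.
have -> : l * x = l * t + - (l * (t - x)) by ring.
rewrite expRD.
have key : expR (- (l * (t - x))) <= l `^ (- e) * (t - x) `^ (- e).
  rewrite -powRM ?(ltW l0) ?(ltW tx)//.
  by apply: expRN_le_powR; rewrite ?mulr_gt0.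
have ge0 : 0 <= (t - x) `^ (b - 1) * expR (l * t).
  by rewrite mulr_ge0 ?powR_ge0 ?expR_ge0.
have alg (A E F L B : R) : 0 <= A * E -> F <= L * B ->
    A * (E * F) <= L * E * (A * B).
  move=> AE FLB; have := ler_wpM2l AE FLB.
  rewrite (_ : A * E * F = A * (E * F)); last by ring.
  by rewrite (_ : A * E * (L * B) = L * E * (A * B)); last by ring.
exact: alg.
Qed.

Lemma integrable_RLint b c t h : 0 < b -> 0 < c -> 0 < t -> weighted c h ->
  mu.-integrable `]0, t[ (fun x => ((t - x) `^ (b - 1) * h x)%:E).
Proof.
move=> b0 c0 t0 [ch /(_ t)[M [M0 hM]]].
have i1 : mu.-integrable `]0, t[
    (fun u => M%:E * ((t - u) `^ (b - 1) * u `^ (c - 1))%:E)%E.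
  by apply: integrableZl => //; exact: integrable_powR_kernel0.
apply: le_integrable i1 => //.
  by apply/measurable_EFinP; apply: measurable_RLint => //; exact: itv0_pos.
move=> x /=; rewrite in_itv/= => /andP[x0 xt].
rewrite lee_fin normrM (ger0_norm (powR_ge0 _ _)).
rewrite [leRHS]ger0_norm ?mulr_ge0 ?powR_ge0// [leRHS]mulrCA ler_wpM2l ?powR_ge0//.
by apply: hM; rewrite x0 ltW.
Qed.

Lemma RLint_le b c A t h : 0 < b -> 0 < c -> 0 < t -> weighted c h ->
  (forall x, 0 < x < t -> `|h x| <= A * x `^ (c - 1)) ->
  `|RLint b h t| <= A * (t `^ (b + c - 1) * beta_int b c).
Proof.
move=> b0 c0 t0 hW hA.
have iR := integrable_RLint b0 c0 t0 hW.
have iK := integrable_powR_kernel0 t0 b0 c0.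
rewrite -Rintegral_powR_kernel0// -RintegralZl//.
apply: (le_trans (le_normr_Rintegral _ _)) => //.
apply: le_Rintegral => //.
- exact: integrable_norm.
- exact: integrable_cstM.
move=> x /=; rewrite in_itv/= => xt.
rewrite normrM (ger0_norm (powR_ge0 _ _)) mulrCA ler_wpM2l ?powR_ge0//.
exact: hA.
Qed.

(** The source of smallness in the contraction: the factor l^(-e) is bought by lowering the kernel
    index from [b] to [b - e], which stays positive and hence integrable. *)
Lemma RLint_le_exp b c e l A t h : 0 < b -> 0 < c -> 0 <= e <= 1 -> e < b ->
  0 < l -> 0 < t -> 0 <= A -> weighted c h ->
  (forall x, 0 < x < t -> `|h x| <= A * (x `^ (c - 1) * expR (l * x))) ->
  `|RLint b h t| <= A * (l `^ (- e) * expR (l * t) *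
    (t `^ (b - e + c - 1) * beta_int (b - e) c)).
Proof.
move=> b0 c0 e01 eb l0 t0 A0 hW hA.
have be : 0 < b - e by rewrite subr_gt0.
have iR := integrable_RLint b0 c0 t0 hW.
have iK := integrable_powR_kernel0 t0 be c0.
rewrite -Rintegral_powR_kernel0// mulrA -RintegralZl//.
apply: (le_trans (le_normr_Rintegral _ _)) => //.
apply: le_Rintegral => //.
- exact: integrable_norm.
- exact: integrable_cstM.
move=> x /=; rewrite in_itv/= => /andP[x0 xt].
rewrite normrM (ger0_norm (powR_ge0 _ _)).
apply: (@le_trans _ _ ((t - x) `^ (b - 1) * (A * (x `^ (c - 1) * expR (l * x))))).
  by rewrite ler_wpM2l ?powR_ge0// hA// x0.
rewrite mulrCA -mulrA ler_wpM2l// mulrCA [leRHS]mulrA [leRHS]mulrC.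
by rewrite ler_wpM2l ?powR_ge0// le_exp_kernel.
Qed.

Lemma RLintB b c t h1 h2 : 0 < b -> 0 < c -> 0 < t ->
  weighted c h1 -> weighted c h2 ->
  RLint b (h1 \- h2) t = RLint b h1 t - RLint b h2 t.
Proof.
move=> b0 c0 t0 w1 w2; rewrite /RLint -RintegralB//.
- by apply: eq_Rintegral => x _; rewrite mulrBr.
- exact: integrable_RLint w1.
- exact: integrable_RLint w2.
Qed.

Lemma RLintD b c t h1 h2 : 0 < b -> 0 < c -> 0 < t ->
  weighted c h1 -> weighted c h2 ->
  RLint b (h1 \+ h2) t = RLint b h1 t + RLint b h2 t.
Proof.
move=> b0 c0 t0 w1 w2; rewrite /RLint -RintegralD//.
- by apply: eq_Rintegral => x _; rewrite mulrDr.
- exact: integrable_RLint w1.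
- exact: integrable_RLint w2.
Qed.

Lemma RLintZ b c k t h : 0 < b -> 0 < c -> 0 < t -> weighted c h ->
  RLint b (fun x => k * h x) t = k * RLint b h t.
Proof.
move=> b0 c0 t0 w; rewrite /RLint -RintegralZl//.
- by apply: eq_Rintegral => x _; rewrite mulrCA.
- exact: integrable_RLint w.
Qed.

Lemma eq_RLint b t h1 h2 : (forall x, 0 < x < t -> h1 x = h2 x) ->
  RLint b h1 t = RLint b h2 t.
Proof.
move=> h12; apply: eq_Rintegral => x; rewrite inE/= in_itv/= => xt.
by rewrite h12.
Qed.

Lemma weightedD c h1 h2 :
  weighted c h1 -> weighted c h2 -> weighted c (h1 \+ h2).
Proof.
move=> [c1 w1] [c2 w2]; split.
  by move=> x x0; apply: cvgD; [exact: c1|exact: c2].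
move=> T; have [M1 [M10 h1M]] := w1 T; have [M2 [M20 h2M]] := w2 T.
exists (M1 + M2); split => [|t t0]; first exact: addr_ge0.
by rewrite mulrDl (le_trans (ler_normD _ _))// lerD// ?h1M ?h2M.
Qed.

Lemma weightedZ c k h : weighted c h -> weighted c (fun x => k * h x).
Proof.
move=> [c1 w1]; split.
  by move=> x x0; apply: cvgMr; exact: c1.
move=> T; have [M [M0 hM]] := w1 T.
exists (`|k| * M); split => [|t t0]; first exact: mulr_ge0.
by rewrite normrM -mulrA ler_wpM2l// hM.
Qed.

Lemma weightedB c h1 h2 :
  weighted c h1 -> weighted c h2 -> weighted c (h1 \- h2).
Proof.
move=> w1 w2; have := weightedD w1 (weightedZ (-1) w2).
by congr weighted; apply/funext => x /=; rewrite mulN1r.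
Qed.

Lemma weighted_powR c : weighted c (fun t => t `^ (c - 1)).
Proof.
split=> [x x0|T]; last first.
  by exists 1; split => // t _; rewrite mul1r ger0_norm ?powR_ge0.
by apply: differentiable_continuous; apply/derivable1_diffP; exact: derivable_powR.
Qed.

End weighted_functions.

(** * Continuity of fractional integrals *)

Section RLint_continuity.
Context {R : realType}.
Notation mu := (@lebesgue_measure R).
Implicit Types (b c s t A : R) (h : R -> R).

Lemma integral_affine (a b : R) (x y : bool) (p q : R) (f : R -> \bar R) :
  0 < b ->
  measurable_fun [set` Interval (BSide x p) (BSide y q)] f ->
  (\int[mu]_(r in [set` Interval (BSide x p) (BSide y q)]) f r =
   b%:E * \int[mu]_(r in
     [set` Interval (BSide x ((p - a) / b)%R) (BSide y ((q - a) / b)%R)])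
       f (a + b * r)%R)%E.
Proof.
move=> b0 mf.
rewrite [LHS]integralE [in RHS]integralE.
pose phi (r : measurableTypeR R) := a + b * r.
rewrite (funepos_comp f phi) (funeneg_comp f phi).
rewrite (@ge0_integral_affine _ a b b0 x y p q f^\+)%E//; last exact: measurable_funepos.
rewrite (@ge0_integral_affine _ a b b0 x y p q f^\-)%E//; last exact: measurable_funeneg.
- set u := integral _ _ _; set v := integral _ _ _.
  have : (0 <= u)%E by exact: integral_ge0.
  have : (0 <= v)%E by exact: integral_ge0.
  have b0E : (0 < b%:E)%E by rewrite lte_fin.
  move: u v => [u| |] [v| |] // _ _.
  + by rewrite -EFinB -!EFinM mulrBr EFinB.
  + by rewrite (gt0_muley b0E) /= (gt0_muleNy b0E).
  + by rewrite (gt0_muley b0E).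
  + by rewrite (gt0_muley b0E) /= (gt0_muleNy b0E).
Qed.

(** Rescaling to (0, 1) moves all dependence on [t] into the integrand, as continuity under the
    integral sign requires. *)
Lemma RLint_scale b t h : 0 < t -> {in `]0, +oo[, continuous h} ->
  RLint b h t = t *
    \int[mu]_(u in `]0%R, 1%R[) ((t - t * u) `^ (b - 1) * h (t * u)).
Proof.
move=> t0 ch; rewrite /RLint /Rintegral.
rewrite (@integral_affine 0 t false true 0 t) ?subr0 ?mul0r ?divff ?gt_eqF//; last first.
  apply/measurable_EFinP; apply: measurable_RLint => //; exact: itv0_pos.
rewrite -[t in RHS]/(fine t%:E).
under [in LHS]eq_integral do rewrite add0r.
(* No integrability is assumed: an infinite integral has real value 0, and multiplying it by t > 0
   keeps it infinite, so both sides are 0. *)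
set I := integral _ _ _; case: I => [r| |]/=; first by [].
  by rewrite mulr0 gt0_muley.
by rewrite mulr0 gt0_muleNy.
Qed.

(** For x in (t/2, 2t) the rescaled integrand is dominated by a constant multiple of the Beta
    kernel. *)
Lemma continuous_RLint b c h : 0 < b -> 0 < c -> weighted c h ->
  {in `]0, +oo[, continuous (RLint b h)}.
Proof.
move=> b0 c0 hW t; rewrite in_itv/= andbT => t0.
have [ch hM] := hW.
pose G x := \int[mu]_(u in `]0%R, 1%R[) ((x - x * u) `^ (b - 1) * h (x * u)).
have cG : {for t, continuous G}.
  have [M [M0 {}hM]] := hM (2 * t).
  (* Bounds x^e on (t/2, 2t) whatever the sign of [e]. *)
  pose C e := (t / 2) `^ e + (2 * t) `^ e : R.
  have C0 e : 0 <= C e by rewrite addr_ge0 ?powR_ge0.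
  have hC x e : t / 2 < x < 2 * t -> x `^ e <= C e.
    move=> /andP[tx xt]; have x0 : 0 < x by rewrite (lt_trans _ tx)// divr_gt0.
    have [e0|/ltW e0] := leP 0 e.
      rewrite ler_wpDl ?powR_ge0//.
      by apply: ge0_ler_powR => //; rewrite ?nnegrE; lra.
    rewrite ler_wpDr ?powR_ge0//.
    by apply: le0_ger_powR => //; lra.
  have m1 x (e : R) : measurable_fun (`]0%R, 1%R[%classic : set R)
      (fun u => (x - x * u) `^ e).
    have := @measurable_powR_affine R `]0%R, 1%R[%classic x (- x) e.
    by congr (measurable_fun _ _); apply/funext => u; rewrite mulNr.
  have m2 x : 0 < x -> measurable_fun (`]0%R, 1%R[%classic : set R)
      (fun u => h (x * u)).
    move=> x0; apply: open_continuous_measurable_fun; first exact: interval_open.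
    move=> u; rewrite inE/= in_itv/= => /andP[u0 u1].
    apply: (@continuous_comp _ _ _ (fun u => x * u) h).
      exact: mulrl_continuous.
    by apply: ch; rewrite in_itv/= andbT mulr_gt0.
  pose D := C (b - 1) * (M * C (c - 1)).
  have D0 : 0 <= D by rewrite !mulr_ge0.
  have iD : mu.-integrable `]0%R, 1%R[
      (EFin \o (fun u => D * ((1 - u) `^ (b - 1) * u `^ (c - 1)))).
    by apply: integrable_cstM => //; exact: integrable_beta.
  have bnd x u : t / 2 < x < 2 * t -> 0 < u < 1 ->
     `|(x - x * u) `^ (b - 1) * h (x * u)| <=
       D * ((1 - u) `^ (b - 1) * u `^ (c - 1)).
    move=> xt /andP[u0 u1].
    have x0 : 0 < x by case/andP : xt => tx _; rewrite (lt_trans _ tx)// divr_gt0.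
    rewrite normrM ger0_norm ?powR_ge0// -{1}(mulr1 x) -mulrBr.
    rewrite powRM ?(ltW x0) ?subr_ge0 ?(ltW u1)//.
    have hxu : `|h (x * u)| <= M * (C (c - 1) * u `^ (c - 1)).
      apply: le_trans (hM _ _) _.
        rewrite mulr_gt0//=; case/andP : xt => _ xt.
        by rewrite (le_trans _ (ltW xt))// ler_piMr// ltW.
      rewrite ler_wpM2l// powRM ?(ltW x0) ?(ltW u0)//.
      by rewrite ler_wpM2r ?powR_ge0// hC.
    rewrite /D; set W := (1 - u) `^ _; set U := u `^ _ in hxu *.
    rewrite [leRHS](_ : _ = C (b - 1) * W * (M * (C (c - 1) * U))); last by ring.
    by rewrite !ler_pM ?mulr_ge0 ?powR_ge0 ?hC.
  have tt : t \in (`](t / 2), (2 * t)[%classic : set R).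
    by rewrite inE/= in_itv/=; apply/andP; split; lra.
  apply: (@continuity_under_integral R _ (measurableTypeR R) mu
    (fun x u => (x - x * u) `^ (b - 1) * h (x * u)) `]0%R, 1%R[
    (measurable_itv _) (t / 2) (2 * t) _ _ _ iD _ t tt).
  - move=> x; rewrite /= in_itv/= => xt.
    apply: le_integrable iD => //.
      apply/measurable_EFinP; apply: measurable_funM; first exact: m1.
      by apply: m2; case/andP : xt => tx _; rewrite (lt_trans _ tx)// divr_gt0.
    move=> u /=; rewrite in_itv/= => u01; rewrite lee_fin.
    by apply: le_trans (bnd _ _ xt u01) _; exact: ler_norm.
  - apply: aeW => u /=; rewrite in_itv/= => /andP[u0 u1] x.
    rewrite inE/= in_itv/= => /andP[tx _].
    have x0 : 0 < x by rewrite (lt_trans _ tx)// divr_gt0.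
    have c1 : {for x, continuous (h \o (fun x => x * u))}.
      apply: continuous_comp; first exact: mulrr_continuous.
      by apply: ch; rewrite in_itv/= andbT mulr_gt0.
    have c2 : {for x, continuous ((fun y => y `^ (b - 1)) \o (fun x => x - x * u))}.
      apply: continuous_comp.
        by apply: cvgB; [exact: cvg_id|exact: mulrr_continuous].
      apply: (weighted_powR b).1; rewrite in_itv/= andbT.
      by rewrite -{1}(mulr1 x) -mulrBr mulr_gt0// subr_gt0.
    exact: (cvgM c2 c1).
  - move=> x; rewrite /= in_itv/= => xt; apply: aeW => u /=; rewrite in_itv/= => u01.
    exact: bnd.
have eG : \forall x \near t, x * G x = RLint b h x.
  near=> x; rewrite RLint_scale//.
  by near: x; exact: lt_nbhsr.
rewrite /prop_for /continuous_at -(nbhs_singleton eG).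
apply: cvg_trans (cvgM (@cvg_id _ _) cG).
exact: near_eq_cvg.
Unshelve. all: by end_near. Qed.

Lemma weighted_RLint b c h : 0 < b -> 0 < c -> weighted c h ->
  weighted c (RLint b h).
Proof.
move=> b0 c0 hW; split; first exact: continuous_RLint hW.
move=> T; have [M [M0 hM]] := hW.2 T.
exists (M * (T `^ b * beta_int b c)); split.
  by rewrite !mulr_ge0 ?powR_ge0 ?beta_int_ge0.
move=> t /andP[t0 tT].
have h1 x : 0 < x < t -> `|h x| <= M * x `^ (c - 1).
  by move=> /andP[x0 xt]; apply: hM; rewrite x0 ltW// (lt_le_trans xt).
apply: (le_trans (RLint_le b0 c0 t0 hW h1)).
have k : t `^ (b + c - 1) <= T `^ b * t `^ (c - 1).
  rewrite -addrA [_ `^ (b + _)]powRD ?(gt_eqF t0) ?implybT// ler_wpM2r ?powR_ge0//.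
  by apply: ge0_ler_powR; rewrite ?nnegrE ?(ltW b0) ?(ltW t0)// ltW// (lt_le_trans t0).
rewrite [leRHS](_ : _ = M * ((T `^ b * t `^ (c - 1)) * beta_int b c)); last by ring.
by rewrite ler_wpM2l// ler_wpM2r ?beta_int_ge0.
Qed.

End RLint_continuity.

(** * Composition of two fractional integrals of total order 1 *)

Section RLint_semigroup.
Context {R : realType}.
Notation mu := (@lebesgue_measure R).
Implicit Types (a b c s t A : R) (h : R -> R).

Let pos_part h (x : R) := if 0 < x then h x else 0.

Let measurable_pos_part h : {in `]0, +oo[, continuous h} ->
  measurable_fun [set: R] (pos_part h).
Proof.
move=> ch; rewrite (_ : pos_part h = h \_ `]0, +oo[).
  apply/(measurable_restrictT _ _).1 => //.
  exact: measurable_pos_continuous.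
apply/funext => x; rewrite patchE /pos_part (_ : (x \in _) = (0 < x))//.
by apply/idP/idP; rewrite inE/= in_itv/= andbT.
Qed.

(* The Fubini integrand, extended by zero off the simplex [0 < v < u < t]. *)
Let F a b t h (z : measurableTypeR R * measurableTypeR R) : R :=
  pos_part (fun x => x `^ (a - 1)) (t - z.1) *
  (pos_part (fun x => x `^ (b - 1)) (z.1 - z.2) * pos_part h z.2).

Let measurable_F a b t h : {in `]0, +oo[, continuous h} ->
  measurable_fun [set: measurableTypeR R * measurableTypeR R] (F a b t h).
Proof.
move=> ch.
have m1 : measurable_fun [set: measurableTypeR R * measurableTypeR R]
    (fst : _ -> measurableTypeR R) by exact: measurable_fst.
have m2 : measurable_fun [set: measurableTypeR R * measurableTypeR R]
    (snd : _ -> measurableTypeR R) by exact: measurable_snd.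
apply: measurable_funM.
  apply: (measurableT_comp (measurable_pos_part (weighted_powR a).1)).
  exact: measurable_funB.
apply: measurable_funM; last exact: (measurableT_comp (measurable_pos_part ch)).
apply: (measurableT_comp (measurable_pos_part (weighted_powR b).1)).
exact: measurable_funB.
Qed.

Let integral_F2 a b c t h u : 0 < b -> 0 < c -> weighted c h ->
  (\int[mu]_v (F a b t h (u, v))%:E =
   (((fun u => (t - u) `^ (a - 1) * RLint b h u) \_ `]0, t[) u)%:E)%E.
Proof.
move=> b0 c0 hW; rewrite patchE; case: ifPn => [|unot].
  rewrite inE/= in_itv/= => /andP[u0 ut].
  have iR := integrable_RLint b0 c0 u0 hW.
  rewrite /RLint EFinM /Rintegral fineK; last exact: integrable_fin_num.
  rewrite -integralZl//= [RHS]integral_mkcond; apply: eq_integral => v _.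
  rewrite patchE; case: ifPn => [|vnot]; rewrite /F /pos_part/= !subr_gt0 ut.
    by rewrite inE/= in_itv/= => /andP[v0 vu]; rewrite v0 vu EFinM.
  have [v0|v0] := ltP 0 v; last by rewrite !mulr0.
  have [vu|vu] := ltP v u; last by rewrite mul0r mulr0.
  by move: vnot; rewrite notin_setE/= in_itv/= v0 vu => /(_ isT).
apply: integral0_eq => v _; congr EFin.
rewrite /F /pos_part/= !subr_gt0.
have [ut|ut] := ltP u t; last by rewrite mul0r.
have [v0|v0] := ltP 0 v; last by rewrite !mulr0.
have [vu|vu] := ltP v u; last by rewrite mul0r mulr0.
by move: unot; rewrite notin_setE/= in_itv/= ut (lt_trans v0 vu) => /(_ isT).
Qed.

(** Since a + b = 1, the power (t - v)^(a+b-1) left by the Beta integral is 1, and the inner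
    integral depends on [v] through [h] alone. *)
Let integral_F1 a b t h v : 0 < a -> 0 < b -> a + b = 1 ->
  (\int[mu]_u (F a b t h (u, v))%:E =
   (((fun v => beta_int a b * h v) \_ `]0, t[) v)%:E)%E.
Proof.
move=> a0 b0 ab; rewrite patchE; case: ifPn => [|vnot].
  rewrite inE/= in_itv/= => /andP[v0 vt].
  transitivity ((h v)%:E * (\int[mu]_(u in `]v, t[)
      ((t - u) `^ (a - 1) * (u - v) `^ (b - 1))%:E))%E.
    rewrite -integralZl//; last exact: integrable_powR_kernel.
    rewrite [RHS]integral_mkcond; apply: eq_integral => u _.
    rewrite patchE; case: ifPn => [|unot]; rewrite /F /pos_part/= !subr_gt0 v0.
      rewrite inE/= in_itv/= => /andP[vu ut]; rewrite vu ut -EFinM; congr EFin.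
      by ring.
    have [ut|ut] := ltP u t; last by rewrite mul0r.
    have [vu|vu] := ltP v u; last by rewrite mul0r mulr0.
    by move: unot; rewrite notin_setE/= in_itv/= vu ut => /(_ isT).
  by rewrite integral_beta_itv// ab subrr powRr0 mul1r -EFinM mulrC.
apply: integral0_eq => u _; congr EFin.
rewrite /F /pos_part/= !subr_gt0.
have [ut|ut] := ltP u t; last by rewrite mul0r.
have [v0|v0] := ltP 0 v; last by rewrite !mulr0.
have [vu|vu] := ltP v u; last by rewrite mul0r mulr0.
by move: vnot; rewrite notin_setE/= in_itv/= v0 (lt_trans vu ut) => /(_ isT).
Qed.

Lemma weighted_norm c h : weighted c h -> weighted c (fun x => `|h x|).
Proof.
move=> [ch hM]; split; last first.
  move=> T; have [M [M0 hMT]] := hM T; exists M; split => // t tT.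
  by rewrite normr_id hMT.
move=> x x0; apply: (continuous_comp (ch _ x0)).
exact: norm_continuous.
Qed.

Lemma integrable_weighted c h t : 0 < c -> 0 < t -> weighted c h ->
  mu.-integrable `]0, t[ (EFin \o h).
Proof.
move=> c0 t0 hW; have := integrable_RLint ltr01 c0 t0 hW.
by congr (integrable _ _ _); apply/funext => x /=; rewrite subrr powRr0 mul1r.
Qed.

(** Both sides are the iterated integrals of [F]: integrating in v first gives the composition,
    integrating in u first gives the primitive of [h] times a Beta value. *)
Lemma RLint_RLint a b c h t : 0 < a -> 0 < b -> a + b = 1 -> 0 < c -> 0 < t ->
  weighted c h ->
  RLint a (RLint b h) t = beta_int a b * \int[mu]_(x in `]0%R, t[) h x.
Proof.
move=> a0 b0 ab c0 t0 hW.
have iF : (mu \x mu)%E.-integrable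
    [set: measurableTypeR R * measurableTypeR R] (EFin \o F a b t h).
  apply/integrable21ltyP.
    by apply/measurable_EFinP; exact: (measurable_F _ _ _ hW.1).
  (* The absolute value of [F] is the [F] built from |h|, so the same inner integral also proves
     integrability on the product. *)
  rewrite (_ : (fun y => _) =
    EFin \o ((fun v => beta_int a b * `|h v|) \_ `]0, t[)); last first.
    apply/funext => v; rewrite /= -(@integral_F1 a b t (fun x => `|h x|) v)//.
    apply: eq_integral => u _ /=; rewrite /F !normrM /pos_part/=.
    by congr ((_ * (_ * _))%:E); case: ifP => _;
      rewrite ?normr0// ger0_norm// powR_ge0.
  rewrite -restrict_EFin -integral_mkcond.
  apply: integrable_lty => //; apply: integrable_cstM => //.
  exact: integrable_weighted (weighted_norm hW).
have e1 : (fun u => \int[mu]_v (F a b t h (u, v))%:E)%E =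
    EFin \o ((fun u => (t - u) `^ (a - 1) * RLint b h u) \_ `]0, t[).
  by apply/funext => u; rewrite (integral_F2 _ _ _ b0 c0 hW).
have e2 : (fun v => \int[mu]_u (F a b t h (u, v))%:E)%E =
    EFin \o ((fun v => beta_int a b * h v) \_ `]0, t[).
  by apply/funext => v; rewrite integral_F1.
have := Fubini iF; rewrite /= e1 e2 -!restrict_EFin -!integral_mkcond.
move=> /(congr1 fine) E.
rewrite -RintegralZl//; exact: integrable_weighted hW.
Qed.

End RLint_semigroup.

(** * Primitives of weighted functions *)

Section primitive_weighted.
Context {R : realType}.
Notation mu := (@lebesgue_measure R).
Implicit Types (a b c s t A : R) (h : R -> R).

Lemma is_derive_primitive c h t : 0 < c -> 0 < t -> weighted c h ->
  is_derive t 1 (fun t => \int[mu]_(x in `]0%R, t[) h x) (h t).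
Proof.
move=> c0 t0 hW.
(* The fundamental theorem is applied on an interval reaching beyond [t], so that [t] is
   interior. *)
have i2 : mu.-integrable [set` Interval (BRight 0) (BRight (t + 1))] (EFin \o h).
  have t2 : 0 < t + 2 by rewrite addr_gt0.
  apply: integrableS (integrable_weighted c0 t2 hW) => //.
  by move=> x /=; rewrite !in_itv/= => /andP[-> /le_lt_trans]; apply; rewrite ltrD2l ltr1n.
have t1 : t < t + 1 by rewrite ltrDl.
have ct : {for t, continuous h} by apply: hW.1; rewrite in_itv/= andbT.
have [d1 d2] := continuous_FTC1 t1 i2 t0 ct.
rewrite derive1E in d2.
apply: near_eq_is_derive (DeriveDef d1 d2).
near=> x; rewrite Rintegral_itv_bndo_bndc//.
apply: integrable_weighted hW => //.
by near: x; exact: lt_nbhsr.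
Unshelve. all: by end_near. Qed.

(** The primitive is [RLint 1 h], which is O(t^c) by the Beta estimate. *)
Lemma primitive_cvg0 c h : 0 < c -> weighted c h ->
  (\int[mu]_(x in `]0%R, t[) h x) @[t --> 0^'+] --> (0 : R).
Proof.
move=> c0 hW; have [M [M0 hM]] := hW.2 1.
apply/norm_cvg0P.
apply: (@squeeze_cvgr _ _ _ _ (cst 0) (fun t => M * (t `^ c * beta_int 1 c))).
- near=> t.
  have t0 : 0 < t by near: t; exact: nbhs_right_gt.
  have t1 : t <= 1 by near: t; exact: nbhs_right_le.
  rewrite normr_ge0/=.
  have hb x : 0 < x < t -> `|h x| <= M * x `^ (c - 1).
    by move=> /andP[x0 xt]; apply: hM; rewrite x0 ltW// (lt_le_trans xt).
  have := RLint_le ltr01 c0 t0 hW hb.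
  rewrite (_ : 1 + c - 1 = c); last by ring.
  apply: le_trans; rewrite le_eqVlt; apply/orP; left; apply/eqP; congr `|_|.
  by apply: eq_Rintegral => x _; rewrite subrr powRr0 mul1r.
- exact: cvg_cst.
- rewrite -[X in _ --> X](mulr0 M) -[X in _ --> M * X](mul0r (beta_int 1 c)).
  by apply: cvgMr; apply: cvgMl; exact: powR_cvg0.
Unshelve. all: by end_near. Qed.

(** [F] need not be continuous at 0. By the mean value theorem its difference with the primitive is
    constant on every [s, t] with s > 0, and the limit at 0+ gives the constant. *)
Lemma primitive_unique c h (F : R -> R) (l t : R) : 0 < c -> weighted c h ->
  (forall t, 0 < t -> is_derive t 1 F (h t)) ->
  F t @[t --> 0^'+] --> l -> 0 < t ->
  F t = l + \int[mu]_(x in `]0%R, t[) h x.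
Proof.
move=> c0 hW dF Fl t0.
pose I t := \int[mu]_(x in `]0%R, t[) h x.
have dI s : 0 < s -> is_derive s 1 I (h s) by move=> s0; exact: is_derive_primitive hW.
have dD s : 0 < s -> is_derive s 1 (F \- I) 0.
  move=> s0; have := dF _ s0; have := dI _ s0 => dIs dFs.
  by rewrite -(subrr (h s)); exact: is_deriveB.
have cst s : 0 < s < t -> F s - I s = F t - I t.
  move=> /andP[s0 st].
  have d x : x \in `]s, t[ -> is_derive x 1 (F \- I) (cst 0 x).
    by rewrite in_itv/= => /andP[sx _]; apply: dD; exact: lt_trans sx.
  have cD : {within `[s, t], continuous (F \- I)}.
    apply: derivable_within_continuous => x; rewrite in_itv/= => /andP[sx _].
    by have := dD x (lt_le_trans s0 sx); case.
  have [z _] := MVT st d cD.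
  by rewrite /= mul0r => /eqP; rewrite subr_eq0 => /eqP.
have c1 : (F \- I) s @[s --> 0^'+] --> l - 0.
  by apply: cvgB => //; exact: primitive_cvg0 hW.
have c2 : (F \- I) s @[s --> 0^'+] --> F t - I t.
  apply/cvgrPdist_lt => e e0; near=> s.
  rewrite /= cst ?subrr ?normr0//.
  apply/andP; split; first by near: s; exact: nbhs_right_gt.
  by near: s; exact: nbhs_right_lt.
have := cvg_unique _ c1 c2; rewrite subr0 => ->//.
by rewrite subrK.
Unshelve. all: by end_near. Qed.

End primitive_weighted.

(** * Positivity of Gamma on (0, 1] *)

Section Gamma_positive.
Context {R : realType}.
Notation mu := (@lebesgue_measure R).

Let measurable_Gamma_integrand (z : R) (D : set R) :
  measurable_fun D (fun t : R => t `^ (z - 1) * expR (- t)).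
Proof.
apply: measurable_funTS; apply: measurable_funM; first exact: measurable_powR.
by apply: measurableT_comp => //; exact: measurable_expR.
Qed.

Lemma integral_expRN_1y :
  (\int[mu]_(t in `[1%R, +oo[) (expR (- t))%:E = (expR (- 1))%:E)%E.
Proof.
have dE (x : R) : is_derive x 1 (fun t : R => - expR (- t)) (expR (- x)).
  have d1 : is_derive x (1 : R) (fun t : R => - t) (- 1) by exact: is_deriveN.
  have d2 := @is_derive1_comp _ expR (fun t => - t) x _ _ (is_derive_expR (- x)) d1.
  have := is_deriveN d2; rewrite mulrN1 opprK; exact.
rewrite (@ge0_continuous_FTC2y R (fun t => expR (- t)) (fun t => - expR (- t)) 1 0).
- by rewrite -EFinB sub0r opprK.
- by move=> x _; exact: expR_ge0.
- apply: derivable_within_continuous => x _.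
  apply: ex_derive.
- rewrite -oppr0; apply: cvgN; exact: cvgr_expR.
- by move=> x _; have [] := dE x.
- apply: cvg_at_right_filter.
  have c1 : {for (1 : R), continuous (fun t : R => - expR (- t))}.
    apply: differentiable_continuous; apply/derivable1_diffP.
    by have [] := dE 1.
  exact: c1.
- by move=> x _; rewrite derive1E; have [] := dE x.
Qed.

(** [Gamma] reads an infinite integral as 0, so finiteness has to be shown as well. Splitting at 1,
    the two pieces are at most 1/z and e^(-1), and the first is at least e^(-1) because t^(z-1) >= 1
    there. *)
Lemma Gamma_gt0 (z : R) : 0 < z -> z <= 1 -> 0 < Gamma z.
Proof.
move=> z0 z1.
set g := (fun t : R => t `^ (z - 1) * expR (- t)).
have g0 t : 0 <= g t by rewrite mulr_ge0 ?powR_ge0 ?expR_ge0.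
have mg (D : set R) : measurable_fun D (EFin \o g).
  by apply/measurable_EFinP; exact: measurable_Gamma_integrand.
have E : (\int[mu]_(t in `]0%R, +oo[) (g t)%:E =
  \int[mu]_(t in `]0%R, 1%R[) (g t)%:E + \int[mu]_(t in `[1%R, +oo[) (g t)%:E)%E.
  rewrite (@itv_bndbnd_setU _ _ (BRight 0) (BLeft 1) +oo%O) ?bnd_simp//.
  apply: ge0_integral_setU => //; first exact: mg.
  - by move=> t _; rewrite lee_fin.
  - apply/disj_setPS => x [/=]; rewrite !in_itv/= => /andP[_ x1].
    by rewrite leNgt x1.
have U1 : (\int[mu]_(t in `]0%R, 1%R[) (g t)%:E <= (z^-1)%:E)%E.
  apply: le_trans (integral_powR_le z0); apply: ge0_le_integral => //.
  - by move=> t _; rewrite lee_fin.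
  - exact: mg.
  - by apply/measurable_EFinP/measurable_funTS; exact: measurable_powR.
  - move=> t /=; rewrite in_itv/= => /andP[t0 _]; rewrite lee_fin.
    by rewrite /g ler_piMr ?powR_ge0// -expR0 ler_expR oppr_le0 ltW.
have U2 : (\int[mu]_(t in `[1%R, +oo[) (g t)%:E <= (expR (- 1))%:E)%E.
  rewrite -integral_expRN_1y; apply: ge0_le_integral => //.
  - by move=> t _; rewrite lee_fin.
  - exact: mg.
  - apply/measurable_EFinP/measurable_funTS.
    by apply: measurableT_comp => //; exact: measurable_expR.
  - move=> t /=; rewrite in_itv/= andbT => t1; rewrite lee_fin.
    rewrite /g ler_piMl ?expR_ge0//.
    by have := @ler_powR _ _ t1 (z - 1) 0; rewrite powRr0; apply; rewrite subr_le0.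
have L : ((expR (- 1))%:E <= \int[mu]_(t in `]0%R, 1%R[) (g t)%:E)%E.
  have -> : (expR (- 1))%:E =
      (\int[mu]_(u in `]0%R, 1%R[) (cst (expR (- 1))%:E u))%E :> \bar R.
    rewrite integral_cst//= lebesgue_measure_itv/= lte_fin ltr01.
    by rewrite sube0 mule1.
  apply: ge0_le_integral => //.
  - by move=> t _; rewrite lee_fin ?expR_ge0.
  - exact: mg.
  - move=> t /=; rewrite in_itv/= => /andP[t0 t1]; rewrite lee_fin.
    apply: (@le_trans _ _ (expR (- t))); first by rewrite ler_expR lerN2 ltW.
    rewrite /g ler_peMl ?expR_ge0//.
    apply: (@le_trans _ _ (1 `^ (z - 1))); first by rewrite powR1.
    by apply: le0_ger_powR => //; rewrite ?subr_le0// ltW.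
rewrite /Gamma /Rintegral E fine_gt0//; apply/andP; split.
- apply: (@lt_le_trans _ _ (expR (- 1))%:E); first by rewrite lte_fin expR_gt0.
  by apply: (le_trans L); rewrite leeDl// integral_ge0// => t _; rewrite lee_fin.
- by apply: le_lt_trans (leeD U1 U2) _; rewrite -EFinD ltry.
Qed.

End Gamma_positive.

(** * Boundedness from compactness and from a limit at 0 *)

Section bounds_on_compacts.
Context {R : realType}.

Lemma compact_continuous_bound (T : topologicalType) (V : normedModType R)
    (A : set T) (f : T -> V) : compact A -> {within A, continuous f} ->
  exists M : R, 0 <= M /\ forall x, A x -> `|f x| <= M.
Proof.
move=> cA cf; have [M [_ hM]] := compact_bounded (continuous_compact cf cA).
exists (`|M| + 1); split => [|x Ax]; first by rewrite addr_ge0.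
by apply: (hM (`|M| + 1)); [rewrite (le_lt_trans (ler_norm M))// ltrDl|exists x].
Qed.

(** The limit controls [u] on some (0, d), and compactness controls it on [d/2, T]. *)
Lemma bounded_near0_right (V : normedModType R) (u : R -> V) (l : V) (T : R) :
  {in `]0, +oo[, continuous u} -> u t @[t --> 0^'+] --> l ->
  exists M : R, 0 <= M /\ forall t, 0 < t <= T -> `|u t| <= M.
Proof.
move=> cu ul.
have : \forall t \near 0^'+, `|l - u t| <= 1 by move/cvgrPdist_le : ul; apply.
move=> [/= d d0 hd].
have cseg : compact `[d / 2, T]%classic by exact: segment_compact.
have cu' : {within `[d / 2, T]%classic, continuous u}.
  apply: continuous_in_subspaceT => t; rewrite inE/= in_itv/= => /andP[dt _].
  by apply: cu; rewrite in_itv/= andbT (lt_le_trans _ dt)// divr_gt0.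
have [M [M0 hM]] := compact_continuous_bound cseg cu'.
exists (M + (`|l| + 1)); split => [|t /andP[t0 tT]]; first by rewrite !addr_ge0.
have [dt|td] := leP (d / 2) t.
  by rewrite ler_wpDr ?addr_ge0// hM//= in_itv/= dt.
rewrite ler_wpDl//.
have : `|l - u t| <= 1.
  apply: hd => //=; rewrite sub0r normrN gtr0_norm// (lt_trans td)//.
  by rewrite ltr_pdivrMr// ltr_pMr// ltr1n.
move=> lu; rewrite (_ : u t = l - (l - u t)); last by rewrite subKr.
by rewrite (le_trans (ler_normB _ _))// lerD.
Qed.

End bounds_on_compacts.

(** * Reduction of vector statements to coordinates *)

Section row_vectors.
Context {R : realType}.
Implicit Types (s : nat) (c : R).

Lemma coord_le_norm s (v : 'rV[R]_s) i : `|v ord0 i| <= `|v|.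
Proof.
rewrite [leRHS]/Num.Def.normr/= mx_normrE.
exact: (le_bigmax _ (fun ij : 'I_1 * 'I_s => `|v ij.1 ij.2|) (ord0, i)).
Qed.

Lemma row_norm_le s (v : 'rV[R]_s) (A : R) : 0 <= A ->
  (forall i, `|v ord0 i| <= A) -> `|v| <= A.
Proof.
move=> A0 vA; rewrite [leLHS]/Num.Def.normr/= mx_normrE.
by apply: bigmax_le => // -[i j] _ /=; rewrite ord1.
Qed.

Lemma row_cvg s (T : Type) (F : set_system T) (FF : Filter F)
    (x : T -> 'rV[R]_s) (l : 'rV[R]_s) :
  (forall i, x t ord0 i @[t --> F] --> l ord0 i) -> x t @[t --> F] --> l.
Proof.
move=> xl; apply/cvgrPdist_le => e e0.
have : \forall t \near F, forall i, `|l ord0 i - x t ord0 i| <= e.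
  by apply: filter_forall => i; move/cvgrPdist_le : (xl i); apply.
apply: filterS => t h; apply: row_norm_le; first exact: ltW.
by move=> i; rewrite !mxE.
Qed.

Lemma row_cvgP s (T : Type) (F : set_system T) (FF : Filter F)
    (x : T -> 'rV[R]_s) (l : 'rV[R]_s) i :
  x t @[t --> F] --> l -> x t ord0 i @[t --> F] --> l ord0 i.
Proof.
move=> xl; apply: (@cvg_comp _ _ _ x (fun v : 'rV[R]_s => v ord0 i) _ _ _ xl).
exact: coord_continuous.
Qed.

Lemma weighted_rowP s c (x : R -> 'rV[R]_s) :
  (forall i, weighted c (fun t => x t ord0 i)) <->
  {in `]0, +oo[, continuous x} /\ forall T : R, exists M : R, 0 <= M /\
    forall t, 0 < t <= T -> `|x t| <= M * t `^ (c - 1).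
Proof.
split=> [xW|[cx hx] i].
  split=> [t t0|T].
    by apply: row_cvg => i; exact: (xW i).1.
  have /choice[M hM] : forall i, exists M : R, 0 <= M /\
      forall t, 0 < t <= T -> `|x t ord0 i| <= M * t `^ (c - 1).
    by move=> i; exact: (xW i).2.
  exists (\sum_i M i); split; first by apply: sumr_ge0 => i _; case: (hM i).
  move=> t tT; apply: row_norm_le.
    by rewrite mulr_ge0 ?powR_ge0// sumr_ge0// => i _; case: (hM i).
  move=> i; have [_ /(_ _ tT)/le_trans] := hM i; apply.
  rewrite ler_wpM2r ?powR_ge0// (bigD1 i)//= lerDl sumr_ge0// => j _.
  by case: (hM j).
split=> [t t0|T].
  by apply: row_cvgP; exact: cx.
have [M [M0 hM]] := hx T; exists M; split => // t tT.
exact: (le_trans (coord_le_norm _ _) (hM _ tT)).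
Qed.

(** The weighted limit at 0 and continuity make t^(1-alpha) x(t) bounded on each (0, T]. *)
Lemma C_weighted_rowP s (alpha : R) (x : R -> 'rV[R]_s) :
  C_weighted (1 - alpha) x -> forall i, weighted alpha (fun t => x t ord0 i).
Proof.
move=> [cx /cvg_ex[l xl]]; apply/weighted_rowP; split => // T.
have cu : {in `]0, +oo[, continuous (fun t => t `^ (1 - alpha) *: x t)}.
  move=> t t0; apply: cvgZ; last exact: cx.
  rewrite (_ : 1 - alpha = (2 - alpha) - 1); last by ring.
  exact: (weighted_powR _).1.
have [M [M0 hM]] := bounded_near0_right T cu xl.
exists M; split => // t tT; have /andP[t0 _] := tT.
have := hM _ tT; rewrite normrZ ger0_norm ?powR_ge0// => h.
by rewrite -opprB powRN ler_pdivlMr ?powR_gt0// mulrC.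
Qed.

End row_vectors.

(** * Equivalence of an arbitrary norm with the sup norm *)

Section norm_equivalence.
Context {R : realType} (s : nat) (N : 'rV[R]_s -> R).
Hypothesis hN : is_norm N.

Let N0 : N 0 = 0.
Proof. by rewrite -(scale0r 0) (is_normZ hN) normr0 mul0r. Qed.

Let N_sum (I : finType) (F : I -> 'rV[R]_s) : N (\sum_i F i) <= \sum_i N (F i).
Proof.
elim/big_ind2 : _ => //; first by rewrite N0.
by move=> x a y b xa yb; rewrite (le_trans (is_normD hN _ _))// lerD.
Qed.

(** Triangle inequality on the expansion of [x] in the canonical basis. *)
Lemma is_norm_le_sup : exists C : R, 0 <= C /\ forall x, N x <= C * `|x|.
Proof.
exists (\sum_j N 'e_j); split; first by apply: sumr_ge0 => j _; exact: is_norm_ge0.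
move=> x; rewrite {1}(row_sum_delta x) (le_trans (N_sum _))//.
rewrite mulr_suml; apply: ler_sum => j _.
by rewrite (is_normZ hN) mulrC ler_wpM2l ?(is_norm_ge0 hN)// coord_le_norm.
Qed.

(** The first comparison makes [N] continuous for the sup norm; hence 1/N is continuous, so bounded,
    on the compact unit sphere, and homogeneity does the rest. *)
Lemma sup_le_is_norm : exists C : R, 0 <= C /\ forall x, `|x| <= C * N x.
Proof.
have [C [C0 hC]] := is_norm_le_sup.
have cN : continuous N.
  move=> x; apply/(@cvgrPdist_le _ _ _ (nbhs x) (nbhs_filter x)) => e e0.
  have C1 : 0 < C + 1 by rewrite ltr_wpDl.
  have /cvgrPdist_le cvx : y @[y --> x] --> x by exact: cvg_id.
  near=> y.
  have h (u v : 'rV[R]_s) : N u - N v <= C * `|u - v|.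
    rewrite lerBlDr (le_trans _ (lerD (hC _) (lexx _)))//.
    by rewrite (le_trans _ (is_normD hN _ _))// subrK.
  apply: (@le_trans _ _ (C * `|x - y|)).
    by rewrite ler_norml h lerNl opprB distrC h.
  apply: (@le_trans _ _ ((C + 1) * `|x - y|)); first by rewrite ler_wpM2r// lerDl.
  rewrite mulrC -ler_pdivlMr//.
  by near: y; apply: cvx; rewrite divr_gt0.
pose S := [set x : 'rV[R]_s | `|x| = 1].
have cS : compact S.
  apply: bounded_closed_compact.
    by exists 1; split => // M M1 x /= ->; exact: ltW.
  apply: (@preimage_closed _ _ (fun x : 'rV[R]_s => `|x|) [set x : R | x = 1]).
    by move=> x _; exact: norm_continuous.
  exact: closed_eq.
have cI : {within S, continuous (fun x => (N x)^-1)}.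
  apply: continuous_in_subspaceT => x; rewrite inE /S/= => x1.
  apply: (@cvgV _ _ _ (nbhs_filter x)); last exact: cN.
  apply/eqP => /(is_norm_eq0 hN) x0; move: x1; rewrite x0 normr0 => /eqP.
  by rewrite eq_sym oner_eq0.
have [M [M0 hM]] := compact_continuous_bound cS cI.
exists M; split => // x.
have [->|x0] := eqVneq x 0; first by rewrite normr0 N0 mulr0.
have nx0 : 0 < `|x| by rewrite normr_gt0.
have Nx0 : 0 < N x.
  rewrite lt_neqAle (is_norm_ge0 hN) andbT eq_sym.
  by apply: contra x0 => /eqP/(is_norm_eq0 hN)/eqP.
have Sx : S (`|x|^-1 *: x).
  by rewrite /S/= normrZ normfV normr_id mulVf ?gt_eqF.
have := hM _ Sx.
rewrite (is_normZ hN) (ger0_norm (x := `|x|^-1)) ?invr_ge0//.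
rewrite invfM invrK ger0_norm; last first.
  by rewrite mulr_ge0// ?invr_ge0 ltW.
by rewrite ler_pdivrMr.
Unshelve. all: by end_near. Qed.

End norm_equivalence.

(** * Abel inversion, behaviour at 0, and contraction *)

Section RLint_inversion.
Context {R : realType}.
Notation mu := (@lebesgue_measure R).
Implicit Types (a b c s t A : R) (h : R -> R).
Variable alpha : R.
Hypothesis alpha01 : 0 < alpha < 1.

Let a0 : 0 < alpha. Proof. by case/andP : alpha01. Qed.
Let a1 : alpha < 1. Proof. by case/andP : alpha01. Qed.
Let b0 : 0 < 1 - alpha. Proof. by rewrite subr_gt0. Qed.

Lemma beta_int_alpha_gt0 : 0 < beta_int (1 - alpha) alpha.
Proof. by apply: beta_int_gt0; rewrite ?b0 ?a0 ?(ltW a1)//= gerBl ltW. Qed.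

(** Abel's argument: applying the integral of order alpha to the zero function gives a positive
    multiple of the primitive of [h], which therefore vanishes; then differentiate. *)
Lemma RLint_onem_inj h : weighted alpha h ->
  (forall t, 0 < t -> RLint (1 - alpha) h t = 0) -> forall t, 0 < t -> h t = 0.
Proof.
move=> hW h0 t t0.
have B0 : 0 < beta_int alpha (1 - alpha).
  by apply: beta_int_gt0; rewrite ?b0 ?a0 ?(ltW a1)//= gerBl ltW.
have I0 s : 0 < s -> \int[mu]_(x in `]0%R, s[) h x = 0.
  move=> s0; have ab : alpha + (1 - alpha) = 1 by rewrite addrC subrK.
  have := RLint_RLint a0 b0 ab a0 s0 hW.
  rewrite (@eq_RLint _ _ _ _ (fun=> 0)); last by move=> x /andP[x0 _]; exact: h0.
  rewrite /RLint; under eq_Rintegral do rewrite mulr0.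
  rewrite Rintegral_cst// mul0r => /esym/eqP.
  by rewrite mulf_eq0 (gt_eqF B0) => /eqP.
have [_ <-] := is_derive_primitive a0 t0 hW.
rewrite (@near_eq_derive _ _ _ _ (fun=> 0)) ?derive_cst//.
near=> s; apply: I0; near: s; exact: lt_nbhsr.
Unshelve. all: by end_near. Qed.

(** The integral is O(t^(2 alpha - 1)), so the weighted quantity is O(t^alpha): the integral term
    does not affect the initial value. *)
Lemma weighted_RLint_cvg0 h : weighted alpha h ->
  t `^ (1 - alpha) * RLint alpha h t @[t --> 0^'+] --> (0 : R).
Proof.
move=> hW; have [M [M0 hM]] := hW.2 1.
apply/norm_cvg0P.
apply: (@squeeze_cvgr _ _ _ _ (cst 0)
  (fun t => M * (t `^ alpha * beta_int alpha alpha))).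
- near=> t.
  have t0 : 0 < t by near: t; exact: nbhs_right_gt.
  have t1 : t <= 1 by near: t; exact: nbhs_right_le.
  rewrite normr_ge0/= normrM ger0_norm ?powR_ge0//.
  have hb x : 0 < x < t -> `|h x| <= M * x `^ (alpha - 1).
    by move=> /andP[x0 xt]; apply: hM; rewrite x0 ltW// (lt_le_trans xt).
  have := RLint_le a0 a0 t0 hW hb.
  rewrite -(ler_pM2l (powR_gt0 (1 - alpha) t0)) => /le_trans; apply.
  rewrite mulrCA ler_wpM2l// mulrA ler_wpM2r ?beta_int_ge0//.
  rewrite -powRD ?(gt_eqF t0) ?implybT//.
  by rewrite (_ : 1 - alpha + (alpha + alpha - 1) = alpha)//; ring.
- exact: cvg_cst.
- rewrite -[X in _ --> X](mulr0 M) -[X in _ --> M * X](mul0r (beta_int alpha alpha)).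
  by apply: cvgMr; apply: cvgMl; exact: powR_cvg0.
Unshelve. all: by end_near. Qed.

(** Near 0 one has |h| <= d x^(alpha-1) with d arbitrarily small, and the integral of order 1 -
    alpha turns this power into the constant B(1-alpha, alpha); hence d = e / B. *)
Lemma RLint_onem_cvg0 h : weighted alpha h ->
  t `^ (1 - alpha) * h t @[t --> 0^'+] --> (0 : R) ->
  RLint (1 - alpha) h t @[t --> 0^'+] --> (0 : R).
Proof.
move=> hW h0; apply/cvgrPdist_le => e e0.
have B0 := beta_int_alpha_gt0.
pose d := e / beta_int (1 - alpha) alpha.
have d0 : 0 < d by rewrite divr_gt0.
have [r /= r0 hr] : \forall t \near 0^'+, `|0 - t `^ (1 - alpha) * h t| <= d.
  by move/cvgrPdist_le : h0; apply.
near=> t.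
have t0 : 0 < t by near: t; exact: nbhs_right_gt.
have tr : t < r by near: t; exact: nbhs_right_lt.
rewrite sub0r normrN.
have hb x : 0 < x < t -> `|h x| <= d * x `^ (alpha - 1).
  move=> /andP[x0 xt].
  have : `|0 - x `^ (1 - alpha) * h x| <= d.
    by apply: hr => //=; rewrite sub0r normrN gtr0_norm// (lt_trans xt).
  rewrite sub0r normrN normrM ger0_norm ?powR_ge0// => hx.
  by rewrite -opprB powRN ler_pdivlMr ?powR_gt0// mulrC.
have := RLint_le b0 a0 t0 hW hb; move/le_trans; apply.
rewrite (_ : 1 - alpha + alpha - 1 = 0); last by ring.
by rewrite powRr0 mul1r /d divfK// gt_eqF.
Unshelve. all: by end_near. Qed.

(* The Bielecki weight [t^(alpha-1) e^(l t)] turns the integral operator into a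
   contraction on (0, T] once [l] is large. *)
Lemma RLint_contraction (T K k : R) : 0 < T -> 0 <= K -> 0 <= k ->
  exists l : R, 0 < l /\ forall h A t, weighted alpha h -> 0 <= A -> 0 < t <= T ->
    (forall x, 0 < x < t -> `|h x| <= K * A * (x `^ (alpha - 1) * expR (l * x))) ->
    k * `|RLint alpha h t| <= A / 2 * (t `^ (alpha - 1) * expR (l * t)).
Proof.
move=> T0 K0 k0.
(* With this value the exponent 2 alpha - e - 1 is e + (alpha - 1): the weight reappears, times t^e
   <= T^e. *)
pose e := alpha / 2.
have e0 : 0 < e by rewrite divr_gt0.
have ea : e < alpha by rewrite /e ltr_pdivrMr// ltr_pMr// ltr1n.
have e01 : 0 <= e <= 1 by rewrite (ltW e0)/= (le_trans (ltW ea))// ltW.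
pose D := k * K * T `^ e * beta_int (alpha - e) alpha.
have D0 : 0 <= D by rewrite !mulr_ge0 ?powR_ge0 ?beta_int_ge0.
(* [l] is chosen so that l^(-e) = 1/X, and D/X <= 1/2; the added 1 keeps [X] positive even when D =
   0. *)
pose X := 2 * (D + 1).
have X0 : 0 < X by rewrite mulr_gt0// ltr_wpDl.
exists (X `^ e^-1); split => [|h A t hW A0 /andP[t0 tT] hA]; first exact: powR_gt0.
set l := X `^ e^-1 in hA *.
have l0 : 0 < l by exact: powR_gt0.
have le : l `^ (- e) = X^-1.
  rewrite /l -powRrM (_ : e^-1 * - e = -1); last by rewrite mulrN mulVf ?gt_eqF.
  by rewrite powR_inv1// ltW.
have KA0 : 0 <= K * A by rewrite mulr_ge0.
have := RLint_le_exp a0 a0 e01 ea l0 t0 KA0 hW hA.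
rewrite le => H.
apply: (le_trans (ler_wpM2l k0 H)).
rewrite (_ : alpha - e + alpha - 1 = e + (alpha - 1)); last by rewrite /e; field.
rewrite [_ `^ (e + _)]powRD ?(gt_eqF t0) ?implybT//.
set E := expR _; set P := t `^ (alpha - 1); set B := beta_int _ _.
rewrite (_ : k * _ = A * (k * K * t `^ e * B * X^-1) * (P * E)); last by ring.
rewrite ler_wpM2r ?mulr_ge0 ?powR_ge0 ?expR_ge0// ler_wpM2l//.
apply: (@le_trans _ _ (D / X)).
  rewrite /D ler_wpM2r ?invr_ge0 ?(ltW X0)// ler_wpM2r ?beta_int_ge0//.
  rewrite ler_wpM2l ?mulr_ge0//.
  by apply: ge0_ler_powR; rewrite ?nnegrE ?(ltW e0) ?(ltW t0) ?(ltW T0).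
rewrite /X ler_pdivrMr//; lra.
Qed.

End RLint_inversion.

(** * Sequences with geometrically decreasing steps *)

Section geometric_limit.
Context {R : realType}.

Lemma half_geometric_small (C e : R) : 0 < e ->
  \forall n \near \oo, `|C / 2 ^+ n| <= e.
Proof.
move=> e0.
have h1 : `|2^-1 : R| < 1 by rewrite ger0_norm ?invr_ge0// invf_lt1// ltr1n.
have /cvgrPdist_le/(_ _ e0) := cvg_geometric C h1.
by apply: filterS => n; rewrite sub0r normrN /geometric /= exprVn.
Qed.

Lemma half_geometric_eq0 (x C : R) : (forall n, `|x| <= C / 2 ^+ n) -> x = 0.
Proof.
move=> h; apply/eqP; rewrite -normr_le0 leNgt; apply/negP => x0.
have x2 : 0 < `|x| / 2 by rewrite divr_gt0.
have [n _ /(_ n (leqnn n))/=] := half_geometric_small C x2.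
have := h n; have := ler_norm (C / 2 ^+ n).
lra.
Qed.

(** The radius r n = 2A/2^n is the sum of all steps from n on, so the intervals
    [u n - r n, u n + r n] are nested; the supremum of their left ends lies in all of them and is
    the limit. *)
Lemma half_geometric_lim (u : nat -> R) (A : R) :
  (forall n, `|u n.+1 - u n| <= A / 2 ^+ n) ->
  forall n, `|u n - limn u| <= 2 * A / 2 ^+ n.
Proof.
move=> uA.
pose r n := 2 * A / 2 ^+ n.
have rS n : r n.+1 = A / 2 ^+ n by rewrite /r exprS; field; rewrite expf_neq0.
have r2 n : r n = A / 2 ^+ n + A / 2 ^+ n by rewrite /r; field; rewrite expf_neq0.
have A0 n : 0 <= A / 2 ^+ n by exact: le_trans (uA n).
have ndl : {homo (fun n => u n - r n) : m n / (m <= n)%N >-> m <= n}.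
  apply/nondecreasing_seqP => n; rewrite rS r2.
  by have := uA n; rewrite ler_norml => /andP[]; lra.
have nir : {homo (fun n => u n + r n) : m n / (m <= n)%N >-> n <= m}.
  apply/nonincreasing_seqP => n; rewrite rS r2.
  by have := uA n; rewrite ler_norml => /andP[]; lra.
have lr m n : u m - r m <= u n + r n.
  apply: (le_trans (ndl m (maxn m n) (leq_maxl _ _))).
  apply: le_trans (nir n (maxn m n) (leq_maxr _ _)).
  by have := A0 (maxn m n); have := r2 (maxn m n); lra.
pose l := sup (range (fun n => u n - r n)).
have hs : has_sup (range (fun n => u n - r n)).
  split; first by exists (u 0%N - r 0%N), 0%N.
  by exists (u 0%N + r 0%N) => _ [n _ <-].
have lu n : `|u n - l| <= r n.
  rewrite ler_norml; apply/andP; split.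
    have : l <= u n + r n by apply: ge_sup; [case: hs|move=> _ [m _ <-]].
    lra.
  have : u n - r n <= l by apply: ub_le_sup; [case: hs|exists n].
  lra.
suff -> : limn u = l by [].
apply/cvg_lim => //; apply/cvgrPdist_le => e e0.
have := half_geometric_small (2 * A) e0; apply: filterS => n.
by move=> /(le_trans (ler_norm _)); rewrite distrC; exact: le_trans (lu n).
Qed.

End geometric_limit.

(** * The fractional derivative in coordinates *)

Section RL_derivative_rows.
Context {R : realType}.
Implicit Types (s : nat) (alpha : R).

Lemma RL_derivativeP s alpha (x : R -> 'rV[R]_s) (t : R) (v : 'rV[R]_s) :
  (RL_derivable alpha x t /\ RL_derivative alpha x t = v) <->
  forall i, is_derive t 1
    (fun t => (Gamma (1 - alpha))^-1 * RLint (1 - alpha) (fun r => x r ord0 i) t)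
    (v ord0 i).
Proof.
have E i : (fun t => (Gamma (1 - alpha))^-1 * RLint (1 - alpha) (fun r => x r ord0 i) t)
    = (fun t => RL_integral (1 - alpha) x t ord0 i).
  by apply/funext => r; rewrite /RL_integral !mxE.
split=> [[dx dv] i|h].
  rewrite E; split; first exact: (derivable_mxP _ _ _).1.
  by rewrite -dv /RL_derivative derive1E derive_mx// mxE.
have dx : RL_derivable alpha x t.
  apply/derivable_mxP => i j; rewrite ord1 -E.
  by have [] := h j.
split => //; rewrite /RL_derivative derive1E derive_mx//.
by apply/rowP => i; rewrite mxE -E; have [] := h i.
Qed.

End RL_derivative_rows.

(** * Lipschitz condition in the sup norm *)

Section local_lipschitz.
Context {R : realType} (s : nat).
Implicit Types (N : 'rV[R]_s -> R) (f : R -> 'rV[R]_s -> 'rV[R]_s).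

(** Either alternative for [L] yields a bound M on [0, T], by compactness in the continuous case; K
    is M times the two constants of the norm equivalence. *)
Lemma local_lipschitz_sup N (hN : is_norm N) f (L : R -> R)
    (hL0 : forall t, 0 <= t -> 0 <= L t)
    (hL : [bounded L t | t in `[0, +oo[%classic] \/
          {within `[0, +oo[%classic, continuous L})
    (hfL : forall t x y, 0 <= t -> N (f t x - f t y) <= L t * N (x - y)) (T : R) :
  exists K : R, 0 <= K /\ forall t x y, 0 <= t <= T ->
    `|f t x - f t y| <= K * `|x - y|.
Proof.
have [C1 [C10 hC1]] := is_norm_le_sup hN.
have [C2 [C20 hC2]] := sup_le_is_norm hN.
have [M [M0 hM]] : exists M, 0 <= M /\ forall t, 0 <= t <= T -> L t <= M.
  case: hL => [[M [_ hM]]|cL].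
    exists (`|M| + 1); split; first by rewrite addr_ge0.
    move=> t /andP[t0 _]; apply: (le_trans (ler_norm _)).
    apply: (hM (`|M| + 1)); first by rewrite (le_lt_trans (ler_norm M))// ltrDl.
    by rewrite /= in_itv/= andbT.
  have cL' : {within `[0, T]%classic, continuous L}.
    apply: continuous_subspaceW cL => t /=; rewrite !in_itv/= andbT.
    by case/andP.
  have [M [M0 hM]] := compact_continuous_bound (@segment_compact _ 0 T) cL'.
  exists M; split => // t tT; apply: (le_trans (ler_norm _)).
  by apply: hM; rewrite /= in_itv.
exists (C2 * (M * C1)); split; first by rewrite !mulr_ge0.
move=> t x y /[dup] tT /andP[t0 _].
apply: (le_trans (hC2 _)); rewrite -!mulrA ler_wpM2l//.
apply: (le_trans (hfL _ _ _ t0)); rewrite ler_pM ?hM ?hC1 ?hL0//.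
exact: is_norm_ge0.
Qed.

End local_lipschitz.

(** * Action of the nonlinearity on the weighted class *)

Section nonlinearity.
Context {R : realType} (s : nat).
Variables (alpha : R) (f : R -> 'rV[R]_s -> 'rV[R]_s).
Hypothesis alpha01 : 0 < alpha < 1.
Hypothesis hf : {within `[0, +oo[%classic `*` setT,
  continuous (fun p : R * 'rV[R]_s => f p.1 p.2)}.
Hypothesis lip : forall T : R, exists K : R, 0 <= K /\ forall t x y, 0 <= t <= T ->
  `|f t x - f t y| <= K * `|x - y|.

Let D : set (R * 'rV[R]_s) := `[0, +oo[%classic `*` setT.

Lemma f_continuous_along (x : R -> 'rV[R]_s) :
  {in `]0, +oo[, continuous x} -> {in `]0, +oo[, continuous (fun t => f t (x t))}.
Proof.
move=> cx t; rewrite in_itv/= andbT => t0.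
have Dt : D (t, x t) by split => //=; rewrite in_itv/= andbT ltW.
have h := (subspace_continuousP _ _).1 hf _ Dt.
move=> P /h; rewrite /= !nbhs_simpl /= => hP.
have cp : (r, x r) @[r --> t] --> (t, x t).
  have ct : x r @[r --> t] --> x t by apply: cx; rewrite in_itv/= andbT.
  exact: (@cvg_pair _ _ _ (nbhs t) (nbhs t) (nbhs (x t)) _ _ _ _ _ cvg_id ct).
have := cp _ hP; rewrite !nbhs_simpl/= => H.
(* The continuity of [f] is relative to the closed half-space, a restriction that is void near t >
   0. *)
have H0 : \forall r \near t, 0 < r by exact: lt_nbhsr.
apply: filterS2 H H0 => r Dr r0.
by apply: Dr; split => //=; rewrite in_itv/= andbT ltW.
Qed.

Lemma f_bounded0 (T : R) : exists M : R, 0 <= M /\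
  forall t, 0 <= t <= T -> `|f t 0| <= M.
Proof.
have c0 : {within `[0, T]%classic, continuous (fun t => f t 0)}.
  apply/subspace_continuousP => t; rewrite /= in_itv/= => /andP[t0 tT].
  have Dt : D (t, 0) by split => //=; rewrite in_itv/= andbT.
  have h := (subspace_continuousP _ _).1 hf _ Dt.
  move=> P /h; rewrite /= !nbhs_simpl /= => hP.
  have cp : (r, 0 : 'rV[R]_s) @[r --> t] --> (t, 0 : 'rV[R]_s).
    have ct : (0 : 'rV[R]_s) @[r --> t] --> (0 : 'rV[R]_s) by exact: cvg_cst.
    exact: (@cvg_pair _ _ _ (nbhs t) (nbhs t) (nbhs (0 : 'rV[R]_s)) _ _ _ _ _ cvg_id ct).
  have := cp _ hP; rewrite !nbhs_simpl/= => H.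
  apply: filterS H => r Dr; rewrite /= in_itv/= => /andP[r0 _].
  by apply: Dr; split => //=; rewrite in_itv/= andbT.
have [M [M0 hM]] := compact_continuous_bound (@segment_compact _ 0 T) c0.
by exists M; split => // t tT; apply: hM; rewrite /= in_itv.
Qed.

(** Linear growth |f(t, x)| <= |f(t, 0)| + K |x|. The bounded first term also fits the weight, since
    1 <= T^(1-alpha) t^(alpha-1) on (0, T]. *)
Lemma weighted_f (x : R -> 'rV[R]_s) :
  (forall i, weighted alpha (fun t => x t ord0 i)) ->
  forall i, weighted alpha (fun t => f t (x t) ord0 i).
Proof.
move=> /weighted_rowP[cx hx]; apply/weighted_rowP; split.
  exact: f_continuous_along.
move=> T; have [M [M0 hM]] := hx T.
have [M1 [M10 hM1]] := f_bounded0 T.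
have [K [K0 hK]] := lip T.
exists (M1 * T `^ (1 - alpha) + K * M); split.
  by rewrite addr_ge0 ?mulr_ge0 ?powR_ge0.
move=> t /[dup] tT /andP[t0 tT'].
have tT0 : 0 <= t <= T by rewrite ltW.
rewrite -[f t (x t)](subrK (f t 0)) addrC (le_trans (ler_normD _ _))//.
rewrite mulrDl lerD//.
  apply: (le_trans (hM1 _ tT0)); rewrite -mulrA ler_peMr//.
  rewrite -(opprB 1 alpha) powRN ler_pdivlMr ?powR_gt0// mul1r.
  case/andP : alpha01 => _ a1.
  by apply: ge0_ler_powR; rewrite ?nnegrE ?subr_ge0 ?(ltW a1) ?(ltW t0)// ltW// (lt_le_trans t0).
apply: (le_trans (hK _ _ _ tT0)); rewrite subr0 -mulrA ler_wpM2l//.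
exact: hM.
Qed.

End nonlinearity.

(** * The Volterra equation: equivalence, uniqueness, existence *)

Section volterra_equation.
Context {R : realType} (s : nat).
Notation mu := (@lebesgue_measure R).
Variables (alpha : R) (f : R -> 'rV[R]_s -> 'rV[R]_s) (x0 : 'rV[R]_s).
Hypothesis alpha01 : 0 < alpha < 1.
Hypothesis hf : {within `[0, +oo[%classic `*` setT,
  continuous (fun p : R * 'rV[R]_s => f p.1 p.2)}.
Hypothesis lip : forall T : R, exists K : R, 0 <= K /\ forall t x y, 0 <= t <= T ->
  `|f t x - f t y| <= K * `|x - y|.

Let a0 : 0 < alpha. Proof. by case/andP : alpha01. Qed.
Let a1 : alpha < 1. Proof. by case/andP : alpha01. Qed.
Let b0 : 0 < 1 - alpha. Proof. by rewrite subr_gt0. Qed.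

Let G := Gamma (1 - alpha).
Let B := beta_int (1 - alpha) alpha.

Let G0 : 0 < G. Proof. by apply: Gamma_gt0 => //; rewrite gerBl ltW. Qed.
Let B0 : 0 < B. Proof. exact: beta_int_alpha_gt0. Qed.

(* [G / B] is 1 / Gamma(alpha), by the Beta-Gamma relation, which is not needed. *)
Let kap := G / B.

Let rows_weighted (x : R -> 'rV[R]_s) :=
  forall i, weighted alpha (fun t => x t ord0 i).

Definition volterra (x : R -> 'rV[R]_s) (t : R) : 'rV[R]_s :=
  t `^ (alpha - 1) *: x0 +
  kap *: \row_i RLint alpha (fun r => f r (x r) ord0 i) t.

Let volterraE x i : (fun t => volterra x t ord0 i) =
  (fun t => x0 ord0 i * t `^ (alpha - 1)) \+
  (fun t => kap * RLint alpha (fun r => f r (x r) ord0 i) t).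
Proof. by apply/funext => t; rewrite /volterra !mxE/= mulrC. Qed.

Let weighted_Jf x i : rows_weighted x ->
  weighted alpha (RLint alpha (fun r => f r (x r) ord0 i)).
Proof. by move=> xW; apply: weighted_RLint => //; exact: weighted_f. Qed.

Lemma weighted_volterra x : rows_weighted x -> rows_weighted (volterra x).
Proof.
move=> xW i; rewrite volterraE; apply: weightedD; apply: weightedZ.
  exact: weighted_powR.
exact: weighted_Jf.
Qed.

(** The exponents add up to 0, so the singular initial term has a constant image, which
    differentiation removes. *)
Let RLint_powR c t : 0 < t ->
  RLint (1 - alpha) (fun r => c * r `^ (alpha - 1)) t = c * B.
Proof.
move=> t0.
rewrite (RLintZ c b0 a0 t0 (weighted_powR alpha)).
have E : RLint (1 - alpha) (fun r => r `^ (alpha - 1)) t =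
    t `^ (1 - alpha + alpha - 1) * B := Rintegral_powR_kernel0 t0 b0 a0.
rewrite {}E.
by rewrite (_ : 1 - alpha + alpha - 1 = 0) ?powRr0 ?mul1r//; ring.
Qed.

(** The composition of the two integrals produces a factor B, and [kap] is chosen so that kap B = G,
    the normalisation of the fractional derivative. *)
Lemma RLint_volterra x i t : rows_weighted x -> 0 < t ->
  RLint (1 - alpha) (fun r => volterra x r ord0 i) t =
  x0 ord0 i * B + G * \int[mu]_(r in `]0%R, t[) f r (x r) ord0 i.
Proof.
move=> xW t0; rewrite volterraE.
rewrite (@RLintD _ _ alpha)//; last 2 first.
- by apply: weightedZ; exact: weighted_powR.
- by apply: weightedZ; exact: weighted_Jf.
rewrite RLint_powR// (RLintZ _ b0 a0 t0 (weighted_Jf i xW)).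
have ba : 1 - alpha + alpha = 1 by rewrite subrK.
rewrite (RLint_RLint b0 a0 ba a0 t0 (weighted_f alpha01 hf lip xW i)).
by rewrite -/B mulrA /kap divfK// gt_eqF.
Qed.

Lemma volterra_solution x : rows_weighted x ->
  (forall t, 0 < t -> x t = volterra x t) ->
  C_weighted (1 - alpha) x /\ RL_solution alpha f x0 x.
Proof.
move=> xW xE.
have xl : t `^ (1 - alpha) *: x t @[t --> 0^'+] --> x0.
  apply: row_cvg => i.
  pose J := RLint alpha (fun r => f r (x r) ord0 i).
  have H : x0 ord0 i + kap * (t `^ (1 - alpha) * J t) @[t --> 0^'+] --> x0 ord0 i.
    rewrite -[X in _ --> X]addr0 -[X in _ --> _ + X](mulr0 kap).
    apply: cvgD; first exact: cvg_cst.
    by apply: cvgMr; exact: weighted_RLint_cvg0 (weighted_f alpha01 hf lip xW i).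
  apply: cvg_trans H; apply: near_eq_cvg; near=> t.
  have t0 : 0 < t by near: t; exact: nbhs_right_gt.
  rewrite /= xE// /volterra !mxE [RHS]mulrDr [t `^ _ * (t `^ _ * _)]mulrA.
  rewrite -[t `^ _ * t `^ _]powRD ?(gt_eqF t0) ?implybT//.
  rewrite (_ : 1 - alpha + (alpha - 1) = 0); last by ring.
  by rewrite powRr0 mul1r [in RHS]mulrCA.
split.
  split; first by case: ((weighted_rowP _ _).1 xW).
  by apply/cvg_ex; exists x0.
split=> // t t0; apply/RL_derivativeP => i.
have dI := is_derive_primitive a0 t0 (weighted_f alpha01 hf lip xW i).
(* After division by [G], the image of [x] is this constant plus the primitive of f along [x]. *)
have dc := is_deriveD (is_derive_cst (G^-1 * (x0 ord0 i * B)) t (1 : R)) dI.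
rewrite add0r in dc; apply: near_eq_is_derive dc.
near=> r; have r0 : 0 < r by near: r; exact: lt_nbhsr.
rewrite (@eq_RLint _ _ _ _ (fun r => volterra x r ord0 i)); last first.
  by move=> u /andP[u0 _]; rewrite -xE.
rewrite RLint_volterra// [RHS]mulrDr; congr (_ + _).
by rewrite mulrA mulVf ?mul1r// gt_eqF.
Unshelve. all: by end_near. Qed.

(** By injectivity it suffices that [y] and [volterra y] have the same integral of order 1 - alpha.
    After division by [G] that of [y] has derivative f(r, y(r)), so only its limit at 0 remains to
    be identified. *)
Lemma solution_volterra y : C_weighted (1 - alpha) y ->
  RL_solution alpha f x0 y -> forall t, 0 < t -> y t = volterra y t.
Proof.
move=> yC [dy yl] t t0.
have yW := C_weighted_rowP yC.
apply/rowP => i; apply/eqP; rewrite -subr_eq0; apply/eqP.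
have hW := weightedB (yW i) (weighted_volterra yW i).
apply: (RLint_onem_inj alpha01 hW) t0 => {}t t0.
rewrite (RLintB b0 a0 t0 (yW i) (weighted_volterra yW i)).
rewrite RLint_volterra//.
(* Removing the singular part leaves weighted limit 0, hence an image tending to 0; the singular
   part contributes the constant x0 B. *)
pose h r := y r ord0 i - x0 ord0 i * r `^ (alpha - 1).
have cW : weighted alpha (fun r => x0 ord0 i * r `^ (alpha - 1)).
  by apply: weightedZ; exact: weighted_powR.
have hW' : weighted alpha h by exact: weightedB.
have hl : r `^ (1 - alpha) * h r @[r --> 0^'+] --> (0 : R).
  have H : (r `^ (1 - alpha) *: y r) ord0 i - x0 ord0 i @[r --> 0^'+] --> (0 : R).
    rewrite -[X in _ --> X](subrr (x0 ord0 i)).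
    by apply: cvgB; [exact: row_cvgP|exact: cvg_cst].
  apply: cvg_trans H; apply: near_eq_cvg; near=> r.
  have r0 : 0 < r by near: r; exact: nbhs_right_gt.
  rewrite /= !mxE /h mulrBr mulrCA -powRD ?(gt_eqF r0) ?implybT//.
  by rewrite (_ : 1 - alpha + (alpha - 1) = 0) ?powRr0 ?mulr1//; ring.
have Fl : G^-1 * RLint (1 - alpha) (fun r => y r ord0 i) r @[r --> 0^'+] -->
    G^-1 * (x0 ord0 i * B).
  apply: cvgMr.
  have H : RLint (1 - alpha) h r + x0 ord0 i * B @[r --> 0^'+] --> x0 ord0 i * B.
    rewrite -[X in _ --> X]add0r.
    by apply: cvgD; [exact: RLint_onem_cvg0|exact: cvg_cst].
  apply: cvg_trans H; apply: near_eq_cvg; near=> r.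
  have r0 : 0 < r by near: r; exact: nbhs_right_gt.
  by rewrite /= /h (RLintB b0 a0 r0 (yW i) cW) RLint_powR// subrK.
have dF (r : R) : 0 < r -> is_derive r 1
    (fun t => G^-1 * RLint (1 - alpha) (fun r => y r ord0 i) t) (f r (y r) ord0 i).
  by move=> r0; exact: (RL_derivativeP _ _ _ _).1 (dy r r0) i.
have E := primitive_unique a0 (weighted_f alpha01 hf lip yW i) dF Fl t0.
apply/eqP; rewrite subr_eq0; apply/eqP/(mulfI (invr_neq0 (lt0r_neq0 G0))).
by rewrite E mulrDr mulKf ?lt0r_neq0.
Unshelve. all: by end_near. Qed.

Lemma volterra_contraction (T : R) : 0 < T ->
  exists l : R, 0 < l /\ forall x y A t, rows_weighted x -> rows_weighted y ->
    0 <= A -> 0 < t <= T ->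
    (forall r, 0 < r < t -> `|x r - y r| <= A * (r `^ (alpha - 1) * expR (l * r))) ->
    `|volterra x t - volterra y t| <= A / 2 * (t `^ (alpha - 1) * expR (l * t)).
Proof.
move=> T0; have [K [K0 hK]] := lip T.
have kap0 : 0 <= kap by rewrite divr_ge0// ltW.
have [l [l0 hl]] := RLint_contraction alpha01 T0 K0 kap0.
exists l; split => // x y A t xW yW A0 tT xy.
have /andP[t0 tT'] := tT.
apply: row_norm_le.
  by rewrite !mulr_ge0 ?powR_ge0 ?expR_ge0 ?invr_ge0.
move=> i; rewrite /volterra !mxE opprD addrACA subrr add0r -mulrBr.
have fx := weighted_f alpha01 hf lip xW i.
have fy := weighted_f alpha01 hf lip yW i.
rewrite -(RLintB a0 a0 t0 fx fy) normrM ger0_norm//.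
apply: hl => //; first exact: weightedB.
move=> r /andP[r0 rt].
have rT : 0 <= r <= T by rewrite ltW//= ltW// (lt_le_trans rt).
apply: le_trans (_ : `|f r (x r) - f r (y r)| <= _).
  by have := coord_le_norm (f r (x r) - f r (y r)) i; rewrite !mxE.
apply: (le_trans (hK _ _ _ rT)); rewrite -mulrA ler_wpM2l//.
by apply: xy; rewrite r0.
Qed.

Lemma weighted_le_exp (x : R -> 'rV[R]_s) (T l : R) : rows_weighted x -> 0 < l ->
  exists M : R, 0 <= M /\ forall t, 0 < t <= T ->
    `|x t| <= M * (t `^ (alpha - 1) * expR (l * t)).
Proof.
move=> /weighted_rowP[_ /(_ T)[M [M0 hM]]] l0; exists M; split => // t tT.
have /andP[t0 _] := tT.
apply: (le_trans (hM _ tT)); rewrite ler_wpM2l// ler_peMr ?powR_ge0//.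
by rewrite -expR0 ler_expR mulr_ge0// ltW.
Qed.

Let rows_weightedB x y : rows_weighted x -> rows_weighted y ->
  rows_weighted (fun t => x t - y t).
Proof.
move=> xW yW i; have := weightedB (xW i) (yW i).
by congr weighted; apply/funext => t; rewrite !mxE.
Qed.

Lemma volterra_unique x y : rows_weighted x -> rows_weighted y ->
  (forall t, 0 < t -> x t = volterra x t) ->
  (forall t, 0 < t -> y t = volterra y t) -> forall t, 0 < t -> x t = y t.
Proof.
(* The point of evaluation itself serves as the horizon [T]. *)
move=> xW yW xE yE T T0.
have [l [l0 hl]] := volterra_contraction T0.
have [M [M0 hM]] := weighted_le_exp T (rows_weightedB xW yW) l0.
have H n : forall t, 0 < t <= T ->
    `|x t - y t| <= M / 2 ^+ n * (t `^ (alpha - 1) * expR (l * t)).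
  elim: n => [t tT|n IH t tT]; first by rewrite expr0 divr1 hM.
  have /andP[t0 tT'] := tT.
  rewrite xE// yE// exprSr invfM (mulrA M).
  apply: hl => //; first by rewrite divr_ge0// exprn_ge0.
  move=> r /andP[r0 rt]; apply: IH; rewrite r0/= ltW//.
  exact: lt_le_trans tT'.
apply/eqP; rewrite -subr_eq0 -normr_eq0; apply/eqP.
apply: (@half_geometric_eq0 _ _ (M * (T `^ (alpha - 1) * expR (l * T)))) => n.
by rewrite normr_id mulrAC; apply: H; rewrite T0/=.
Qed.

(** The starting function is the solution for f = 0; it already carries the singularity at 0. *)
Let picard (n : nat) : R -> 'rV[R]_s :=
  iter n volterra (fun t => t `^ (alpha - 1) *: x0).

Let weighted_picard n : rows_weighted (picard n).
Proof.
elim: n => [i|n IH]; last exact: weighted_volterra.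
have := weightedZ (x0 ord0 i) (weighted_powR alpha).
by congr weighted; apply/funext => t; rewrite !mxE mulrC.
Qed.

(** A pointwise limit chosen without reference to a horizon, so the estimates on all (0, T] concern
    one function and no gluing arises. *)
Let xlim (t : R) : 'rV[R]_s := \row_i limn (fun n => picard n t ord0 i).

(** The contraction property is carried along because it must hold for the same [l] as the rate of
    convergence. *)
Let picard_cauchy (T : R) : 0 < T -> exists l M : R, [/\ 0 < l, 0 <= M,
  (forall x y A t, rows_weighted x -> rows_weighted y ->
    0 <= A -> 0 < t <= T ->
    (forall r, 0 < r < t -> `|x r - y r| <= A * (r `^ (alpha - 1) * expR (l * r))) ->
    `|volterra x t - volterra y t| <= A / 2 * (t `^ (alpha - 1) * expR (l * t))) &
  forall n t, 0 < t <= T ->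
    `|picard n t - xlim t| <= M / 2 ^+ n * (t `^ (alpha - 1) * expR (l * t))].
Proof.
move=> T0; have [l [l0 hl]] := volterra_contraction T0.
have [M [M0 hM]] := weighted_le_exp T
  (rows_weightedB (weighted_picard 1) (weighted_picard 0)) l0.
have H n : forall t, 0 < t <= T -> `|picard n.+1 t - picard n t| <=
    M / 2 ^+ n * (t `^ (alpha - 1) * expR (l * t)).
  elim: n => [t tT|n IH t tT]; first by rewrite expr0 divr1 hM.
  have /andP[t0 tT'] := tT.
  rewrite exprSr invfM (mulrA M); apply: hl => //; first exact: (weighted_picard n.+1).
    by rewrite divr_ge0// exprn_ge0.
  move=> r /andP[r0 rt]; apply: IH; rewrite r0/= ltW//.
  exact: lt_le_trans tT'.
(* The factor 2 sums the geometric tail of the steps. *)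
exists l, (2 * M); split => //; first by rewrite mulr_ge0.
move=> n t tT; set w := _ `^ _ * _.
have w0 : 0 <= w by rewrite mulr_ge0 ?powR_ge0 ?expR_ge0.
apply: row_norm_le; first by rewrite mulr_ge0// divr_ge0 ?mulr_ge0// exprn_ge0.
move=> i; rewrite !mxE.
rewrite mulrAC -(mulrA 2 M w).
apply: (@half_geometric_lim _ (fun n => picard n t ord0 i) (M * w)) => k.
rewrite mulrAC; apply: le_trans (H k t tT).
by have := coord_le_norm (picard k.+1 t - picard k t) i; rewrite !mxE.
Qed.

(** Convergence is uniform only where the weight is bounded, that is locally on (0, oo); this
    suffices for continuity, by splitting the error into three parts. *)
Let weighted_xlim : rows_weighted xlim.
Proof.
apply/weighted_rowP; split; last first.
  move=> T; have [T0|T0] := ltP 0 T; last first.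
    exists 0; split => // t /andP[t0 /(lt_le_trans t0)].
    by rewrite ltNge T0.
  have [l [M [l0 M0 _ hM]]] := picard_cauchy T0.
  have [M1 [M10 hM1]] := ((weighted_rowP _ _).1 (weighted_picard 0)).2 T.
  exists (M1 + M * expR (l * T)); split.
    by rewrite addr_ge0// mulr_ge0// expR_ge0.
  move=> t tT; have /andP[t0 tT'] := tT.
  rewrite -[xlim t](subKr (picard 0 t)) (le_trans (ler_normB _ _))// mulrDl lerD ?hM1//.
  apply: (le_trans (hM 0%N _ tT)); rewrite expr0 divr1 -mulrA ler_wpM2l//.
  rewrite mulrC ler_wpM2r ?powR_ge0// ler_expR ler_wpM2l// ltW//.
move=> t; rewrite in_itv/= andbT => t0.
(* The horizon lies beyond [t], so the estimates hold on a neighbourhood of [t]. *)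
have T0 : 0 < t + 1 by rewrite addr_gt0.
have [l [M [l0 M0 _ hM]]] := picard_cauchy T0.
pose w r := r `^ (alpha - 1) * expR (l * r).
have cw : w r @[r --> t] --> w t.
  apply: cvgM; first by apply: (weighted_powR alpha).1; rewrite in_itv/= andbT.
  apply: (@continuous_comp _ _ _ (fun r => l * r) expR).
    exact: mulrl_continuous.
  exact: continuous_expR.
apply/cvgrPdist_le => e e0.
have e3 : 0 < e / 3 by rewrite divr_gt0.
(* [w t + 1] bounds the weight near [t], so a single [n] serves a whole neighbourhood. *)
have [n _ /(_ n (leqnn n))/= hn] := half_geometric_small (M * (w t + 1)) e3.
have small r : 0 < r <= t + 1 -> w r <= w t + 1 -> `|picard n r - xlim r| <= e / 3.
  move=> rT wr; apply: (le_trans (hM n r rT)); apply: le_trans hn.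
  apply: le_trans (ler_norm _); rewrite [leRHS]mulrAC ler_wpM2l//.
  by rewrite divr_ge0// exprn_ge0.
have cp : picard n r @[r --> t] --> picard n t.
  by apply: ((weighted_rowP _ _).1 (weighted_picard n)).1; rewrite in_itv/= andbT.
near=> r.
have r0 : 0 < r by near: r; exact: lt_nbhsr.
have rt : r <= t + 1 by apply/ltW; near: r; apply: lt_nbhsl; rewrite ltrDl.
have wr : w r <= w t + 1.
  have : `|w t - w r| <= 1 by near: r; move/cvgrPdist_le : cw; apply.
  by rewrite ler_norml => /andP[]; lra.
have h1 : `|picard n t - picard n r| <= e / 3.
  by near: r; move/cvgrPdist_le : cp; apply.
have h2 : `|picard n r - xlim r| <= e / 3 by apply: small => //; rewrite r0.
have h3 : `|picard n t - xlim t| <= e / 3.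
  by apply: small; rewrite ?t0 ?lerDl ?ler01.
have tele (a b p q : 'rV[R]_s) : a - b = (p - q) + (q - b) - (p - a).
  by rewrite addrA subrK opprB [RHS]addrC addrA subrK.
rewrite (tele _ _ (picard n t) (picard n r)).
apply: (le_trans (ler_normB _ _)).
have := ler_normD (picard n t - picard n r) (picard n r - xlim r).
lra.
Unshelve. all: by end_near. Qed.

(** The iterate n+1 is close to [xlim] by convergence and close to [volterra xlim] by contraction
    from iterate n; the two errors are equal and add up to M w / 2^n. *)
Lemma volterra_fixpoint : exists x : R -> 'rV[R]_s,
  rows_weighted x /\ forall t, 0 < t -> x t = volterra x t.
Proof.
exists xlim; split => // T T0.
have [l [M [l0 M0 hl hM]]] := picard_cauchy T0.
apply/eqP; rewrite -subr_eq0 -normr_eq0; apply/eqP.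
set w := T `^ (alpha - 1) * expR (l * T).
apply: (@half_geometric_eq0 _ _ (M * w)) => n.
have TT : 0 < T <= T by rewrite T0/=.
rewrite normr_id -(subrKA (picard n.+1 T)) (le_trans (ler_normD _ _))//.
have h1 : `|xlim T - picard n.+1 T| <= M / 2 ^+ n.+1 * w by rewrite distrC hM.
have h2 : `|picard n.+1 T - volterra xlim T| <= M / 2 ^+ n / 2 * w.
  apply: hl => //; first by rewrite divr_ge0// exprn_ge0.
  move=> r /andP[r0 rT]; apply: hM; rewrite r0 ltW//.
rewrite (_ : M * w / 2 ^+ n = M / 2 ^+ n.+1 * w + M / 2 ^+ n / 2 * w) ?lerD//.
by rewrite exprS; field; rewrite expf_neq0.
Qed.

End volterra_equation.

Theorem theorem3p1 (R : realType) (s : nat) (hs : (1 <= s)%N)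
    (N : 'rV[R]_s -> R) (hN : is_norm N)
    (alpha : R) (halpha : 0 < alpha < 1)
    (f : R -> 'rV[R]_s -> 'rV[R]_s)
    (hf : {within `[0, +oo[%classic `*` setT,
             continuous (fun p : R * 'rV[R]_s => f p.1 p.2)})
    (L : R -> R) (hL0 : forall t, 0 <= t -> 0 <= L t)
    (hL : [bounded L t | t in `[0, +oo[%classic] \/
          {within `[0, +oo[%classic, continuous L})
    (hfL : forall t x y, 0 <= t -> N (f t x - f t y) <= L t * N (x - y))
    (x0 : 'rV[R]_s) :
  exists x : R -> 'rV[R]_s,
    [/\ C_weighted (1 - alpha) x,
        RL_solution alpha f x0 x &
        forall y : R -> 'rV[R]_s,
          C_weighted (1 - alpha) y -> RL_solution alpha f x0 y ->
          forall t, 0 < t -> y t = x t].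
Proof.
have lip := local_lipschitz_sup hN hL0 hL hfL.
have [x [xW xE]] := volterra_fixpoint x0 halpha hf lip.
have [xC xS] := volterra_solution halpha hf lip xW xE.
exists x; split => // y yC yS; apply: (volterra_unique halpha hf lip) xE => //.
  exact: C_weighted_rowP.
exact: solution_volterra.
Qed.
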